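(* Let $n\ge2$, let $\mathcal{E}$ be a basis of $\mathbb{R}^{n+1}$ and let $\|\cdot\|$ be a norm on $\mathbb{R}^{n+1}$. Then there exist real constants $A,B>0$ such that $$\frac{A}{\|b_I\|^{n+1}}\le\mu(Z_I)\le\frac{B}{\|b_I\|^{n+1}}$$ for all but finitely many multi-indices $I$.
   Context: For a nonzero vector $v\in\mathbb{R}^{n+1}$, $[v]\in\mathbb{R}\mathrm{P}^n$ denotes its direction. For an ordered basis $\mathcal{E}=\{e_1,\dots,e_{n+1}\}$ of $\mathbb{R}^{n+1}$ and $j\in\{1,\dots,n+1\}$, $\mathcal{E}_j=\{e^j_1,\dots,e^j_{n+1}\}$ is the basis with $e^j_j=e_j$ and $e^j_i=e_i+e_j$ for $i\ne j$. For a multi-index $I=i_1i_2\cdots i_k$ with entries in $\{1,\dots,n+1\}$, $|I|=k$, define recursively $\mathcal{E}_{\emptyset}=\mathcal{E}$ and $\mathcal{E}_{i_1\cdots i_k}=(\mathcal{E}_{i_1\cdots i_{k-1}})_{i_k}$. The barycenter $b_I\in\mathbb{R}^{n+1}$ is the sum of the $n+1$ vectors of $\mathcal{E}_I$. $S(\mathcal{E})=\{[\sum_{i} t_ie_i] : t_i\ge 0 \text{ not all } 0\}$ is the closed projective $n$-simplex with vertices $[e_i]$ containing $[e_1+\dots+e_{n+1}]$. The body of a basis $\mathcal{B}=\{f_1,\dots,f_{n+1}\}$ is the projective polytope $Z(\mathcal{B})=\{[\sum_{i<j}t_{ij}(f_i+f_j)] : t_{ij}\ge0\text{ not all }0\}\subset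 S(\mathcal{B})$, with vertices the $n(n+1)/2$ points $[f_i+f_j]$, $i\neq j$; $Z_I=Z(\mathcal{E}_I)$. $\mu$ is the measure induced on $\mathbb{R}\mathrm{P}^n$ by the canonical measure of the sphere $\mathbb{S}^n$, or the one induced by the Lebesgue measure of an affine chart of $\mathbb{R}\mathrm{P}^n$ containing $S(\mathcal{E})$. The constants $A,B$ may depend on $\mathcal{E}$, $\mu$ and the norm. *)

(* Defs.v *)
From HB Require Import structures.
From mathcomp Require Import all_boot all_order all_algebra.
From mathcomp Require Import all_classical all_reals all_analysis.

Set Implicit Arguments.
Unset Strict Implicit.
Unset Printing Implicit Defensive.

Import Order.TTheory GRing.Theory Num.Theory.
Import numFieldNormedType.Exports.

Local Open Scope classical_set_scope.
Local Open Scope ring_scope.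

(* The m-fold product of the Lebesgue measure of R, by recursion on m.  It lives
   on m.-tuple R because this type carries the product sigma-algebra. *)
Section lebesgue_step.
Local Open Scope ereal_scope.
Variables (R : realType) (m : nat).
Variable mu : {sigma_finite_measure set (m.-tuple R) -> \bar R}.

Definition tcons (p : measurableTypeR R * m.-tuple R) : m.+1.-tuple R :=
  [tuple of p.1 :: p.2].

Let measurable_tcons : measurable_fun setT tcons.
Proof. exact: (@measurable_cons _ _ _ R fst _ snd). Qed.

Let measurable_tconsI A : measurable A -> measurable (tcons @^-1` A).
Proof. by move=> mA; rewrite -[_ @^-1` _]setTI; exact: measurable_tcons. Qed.

Definition lebesgue_step : set (m.+1.-tuple R) -> \bar R :=
  pushforward (lebesgue_measure \x mu) tcons.

Let step0 : lebesgue_step set0 = 0.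
Proof. by rewrite /lebesgue_step /pushforward preimage_set0 measure0. Qed.

Let step_ge0 A : 0 <= lebesgue_step A.
Proof. exact: measure_ge0. Qed.

Let step_sigma_additive : semi_sigma_additive lebesgue_step.
Proof.
move=> F mF tF mUF; rewrite /lebesgue_step /pushforward preimage_bigcup.
apply: measure_semi_sigma_additive.
- by move=> i; exact: measurable_tconsI.
- apply/trivIsetP => /= i j _ _ ij; rewrite -preimage_setI.
  by move/trivIsetP : tF => /(_ _ _ _ _ ij) ->//; rewrite preimage_set0.
- by rewrite -preimage_bigcup; exact: measurable_tconsI.
Qed.

HB.instance Definition _ := isMeasure.Build _ _ _ lebesgue_step
  step0 step_ge0 step_sigma_additive.

Let step_sigma_finite : sigma_finite setT lebesgue_step.
Proof.
have /sigma_finiteP[F [TF ndF Foo]] := sigma_finiteT (@lebesgue_measure R).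
have /sigma_finiteP[G [TG ndG Goo]] := sigma_finiteT mu.
pose H k := [set t : m.+1.-tuple R | F k (thead t) /\ G k [tuple of behead t]].
have HE k : tcons @^-1` H k = F k `*` G k.
  apply/seteqP; split => -[x t]; rewrite /H /tcons /= /thead tnth0 /=;
    by rewrite (_ : [tuple of _] = t) //; apply/val_inj.
have mH k : measurable (H k).
  have [[mF _] [mG _]] := (Foo k, Goo k).
  apply: measurableI.
  - rewrite -[X in measurable X]setTI.
    exact: (@measurable_tnth _ R m.+1 ord0).
  - by rewrite -[X in measurable X]setTI; exact: measurable_behead.
exists H.
  apply/esym; rewrite -subTset => t _.
  have [i _ Fi] : (\bigcup_i F i) (thead t) by rewrite -TF.
  have [j _ Gj] : (\bigcup_i G i) [tuple of behead t] by rewrite -TG.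
  exists (maxn i j) => //; split.
  - by move: Fi; exact/subsetPset/ndF/leq_maxl.
  - by move: Gj; exact/subsetPset/ndG/leq_maxr.
move=> k; split => //; have [[mF Fk] [mG Gk]] := (Foo k, Goo k).
rewrite /lebesgue_step /pushforward HE product_measure1E//.
by rewrite lte_mul_pinfty// ge0_fin_numE.
Qed.

HB.instance Definition _ :=
  Measure_isSigmaFinite.Build _ _ _ lebesgue_step step_sigma_finite.

End lebesgue_step.

Fixpoint lebesgue_tuple (R : realType) (m : nat) :
    {sigma_finite_measure set (m.-tuple R) -> \bar R} :=
  match m with
  | 0 => \d_([tuple] : 0.-tuple R)
  | k.+1 => lebesgue_step (lebesgue_tuple R k)
  end.

Definition lebesgue_rV (R : realType) (m : nat) (A : set 'rV[R]_m) : \bar R :=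
  lebesgue_tuple R m [set t | A (\row_i tnth t i)].

Lemma lebesgue_tuple_box (R : realType) (m : nat) (A : 'I_m -> set R) :
  (forall i, measurable (A i)) ->
  lebesgue_tuple R m [set t | forall i, A i (tnth t i)] =
  (\prod_(i < m) lebesgue_measure (A i))%E.
Proof.
elim: m A => [|m IH] A mA.
  by rewrite big_ord0 /= diracE mem_set// => -[].
rewrite big_ord_recl -IH// /lebesgue_tuple -/lebesgue_tuple /=.
rewrite /lebesgue_step /pushforward -product_measure1E//.
- congr (_ _); apply/seteqP; split => -[x t] /= h.
  + by split => [|i]; [exact: (h ord0)|have := h (lift ord0 i); rewrite tnthS].
  + move=> i; have [j ->|->] := unliftP ord0 i; last exact: h.1.
    by rewrite tnthS; exact: h.2.
- exact: mA.
rewrite (_ : mkset _ =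
    \bigcap_(i in [set: 'I_m])
      [set t : m.-tuple R | A (lift ord0 i) (tnth t i)]).
  apply: fin_bigcap_measurable => // i _.
  rewrite -[X in measurable X]setTI.
  exact: (@measurable_tnth _ R m i measurableT _ (mA _)).
by apply/seteqP; split => t h i *; exact: h.
Qed.

(* RP^n: the lines through the origin of R^{n+1}. *)
Definition RP (R : realType) (n : nat) :=
  {L : {vspace 'rV[R]_n.+1} | \dim L == 1%N}.

Section projective_space.
Variables (R : realType) (n : nat).
Implicit Types (v : 'rV[R]_n.+1) (B : n.+1.-tuple 'rV[R]_n.+1).

Lemma dim_line v : v != 0 -> \dim <[v]>%VS == 1%N.
Proof. by move=> v0; rewrite dim_vline v0. Qed.

Lemma delta00_neq0 : (delta_mx 0 0 : 'rV[R]_n.+1) != 0.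
Proof.
by apply/eqP => /matrixP /(_ 0 0); rewrite !mxE !eqxx => /eqP; rewrite oner_eq0.
Qed.

Definition base_point : RP R n :=
  exist _ <[delta_mx 0%R 0%R]>%VS (dim_line delta00_neq0).

(* [v]; the value at v = 0 is junk. *)
Definition dir v : RP R n := insubd base_point <[v]>%VS.

Lemma val_dir v : v != 0 -> val (dir v) = <[v]>%VS.
Proof. by move=> v0; rewrite /dir insubdK//; exact: dim_line. Qed.

Definition simplex B : set (RP R n) :=
  [set L | exists t : 'I_n.+1 -> R,
    [/\ forall i, 0 <= t i,
        exists i, t i != 0 &
        L = dir (\sum_i t i *: tnth B i)]].

Definition body B : set (RP R n) :=
  [set L | exists t : 'I_n.+1 -> 'I_n.+1 -> R,
    [/\ forall i j : 'I_n.+1, (i < j)%N -> 0 <= t i j,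
        exists i j : 'I_n.+1, (i < j)%N /\ t i j != 0 &
        L = dir (\sum_(i < n.+1) \sum_(j < n.+1 | (i < j)%N)
                   t i j *: (tnth B i + tnth B j))]].

Definition basis_step B (j : 'I_n.+1) : n.+1.-tuple 'rV[R]_n.+1 :=
  [tuple if i == j then tnth B j else tnth B i + tnth B j | i < n.+1].

Definition basis_at B (I : seq 'I_n.+1) : n.+1.-tuple 'rV[R]_n.+1 :=
  foldl basis_step B I.

Definition barycenter B (I : seq 'I_n.+1) : 'rV[R]_n.+1 :=
  \sum_i tnth (basis_at B I) i.

(* The canonical measure of S^n as the cone measure: the area of A is n+1 times
   the volume of the cone over A in the unit ball. *)
Definition unit_sphere : set 'rV[R]_n.+1 := [set u | \sum_i u 0 i ^+ 2 = 1].

Definition unit_cone (A : set 'rV[R]_n.+1) : set 'rV[R]_n.+1 :=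
  [set x | exists (r : R) (u : 'rV[R]_n.+1),
    [/\ 0 < r <= 1, unit_sphere u, A u & x = r *: u]].

Definition sphere_measure (A : set 'rV[R]_n.+1) : \bar R :=
  ((n.+1)%:R%:E * lebesgue_rV (unit_cone A))%E.

Definition proj_sphere_measure (A : set (RP R n)) : \bar R :=
  sphere_measure (dir @^-1` A).

(* The affine chart with homogeneous coordinates (1, x) in the frame of R^{n+1}
   given by the rows of the invertible matrix T. *)
Definition chart (T : 'M[R]_n.+1) (x : 'rV[R]_n) : RP R n :=
  dir ((row_mx 1%:M x : 'rV[R]_n.+1) *m T).

Definition chart_measure (T : 'M[R]_n.+1) (A : set (RP R n)) : \bar R :=
  lebesgue_rV (chart T @^-1` A).

Definition admissible_measure B (mu : set (RP R n) -> \bar R) : Prop :=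
  mu = proj_sphere_measure \/
  exists T : 'M[R]_n.+1,
    [/\ T \in unitmx, simplex B `<=` range (chart T) & mu = chart_measure T].

End projective_space.

Definition is_norm (R : realType) (m : nat) (N : 'rV[R]_m -> R) : Prop :=
  [/\ forall x y, N (x + y) <= N x + N y,
      forall a x, N (a *: x) = `|a| * N x &
      forall x, N x = 0 -> x = 0].

(* Main.v *)
(* Only the smallest of the numbers x_i = l(f_i), for l a linear form positive on
   the initial basis and (f_i) the basis E_I, can be small compared to the others:
   an inequality x_i <= C (x_k + x_l) for all i and all k <> l survives each step.
   Hence l(b_I) = sum_i x_i is comparable to l(f_i + f_j) at every vertex of Z_I,
   and the part of the cone over Z_I cut out by l <= 1 lies between the images
   under E_I of two boxes of side comparable to 1 / l(b_I).  The steps are shears,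
   so these images have volume comparable to 1 / l(b_I)^(n+1), which gives the
   bounds for every I, without exception.

   The behaviour of the volume under linear maps comes from the uniqueness of
   translation-invariant measures: a fixed map multiplies volumes by a constant,
   and this constant is 1 for a shear because a shear is conjugate to its inverse. *)
Require Import Defs.
From mathcomp Require Import all_boot all_order all_algebra.
From mathcomp Require Import all_classical all_reals all_analysis.
From mathcomp Require Import measurable_realfun.
From mathcomp Require Import ring lra.

Import Order.TTheory GRing.Theory Num.Theory.
Import numFieldNormedType.Exports.
Local Open Scope classical_set_scope.
Local Open Scope ring_scope.

Set Implicit Arguments.
Unset Strict Implicit.
Unset Printing Implicit Defensive.

(** * Lebesgue measure of row vectors *)

(** The integral of a nonnegative function is the supremum over the simple functions below it, a
    family that grows with the function. Hence volumes can be compared by inclusion for arbitrary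
    sets, such as the cone over a body. *)
Lemma le_ge0_integral d (T : measurableType d) (R : realType)
    (mu : {measure set T -> \bar R}) (f g : T -> \bar R) :
  (forall x, 0 <= f x)%E -> (forall x, f x <= g x)%E ->
  (\int[mu]_x f x <= \int[mu]_x g x)%E.
Proof.
move=> f0 fg; have g0 x : (0 <= g x)%E by apply: le_trans (fg x).
rewrite !ge0_integralTE//; apply: ge_ereal_sup => _ [h/= hf <-].
by apply: ereal_sup_ubound; exists h => //= x; apply: le_trans (fg x).
Qed.

Lemma le_lebesgue_tuple (R : realType) m (A B : set (m.-tuple R)) :
  A `<=` B -> (lebesgue_tuple R m A <= lebesgue_tuple R m B)%E.
Proof.
elim: m A B => [|m IH] A B AB.
  rewrite /= !diracE lee_fin ler_nat.
  have [/set_mem /AB /mem_set ->//|_] := boolP (_ \in A); exact: leq0n.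
rewrite /lebesgue_tuple -/lebesgue_tuple /= /lebesgue_step /pushforward.
rewrite /product_measure1; apply: le_ge0_integral => x //=.
by apply: IH => t; rewrite /xsection /= !inE; exact: AB.
Qed.

Lemma measurable_preimageT d1 d2 (T1 : measurableType d1)
    (T2 : measurableType d2) (f : T1 -> T2) (A : set T2) :
  measurable_fun setT f -> measurable A -> measurable (f @^-1` A).
Proof. by move=> mf mA; rewrite -[X in measurable X]setTI; exact: mf. Qed.

(** The pushforward under the translation gives each interval its length, so it is Lebesgue measure
    by uniqueness. *)
Lemma lebesgue_measure_translate (R : realType) (a : R)
    (A : set (measurableTypeR R)) : measurable A ->
  lebesgue_measure ((fun x => x + a) @^-1` A) = lebesgue_measure A.
Proof.
move=> mA.
have mf : measurable_fun [set: measurableTypeR R]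
    ((fun x => x + a) : measurableTypeR R -> measurableTypeR R).
  by apply: measurable_funD => //; exact: measurable_cst.
pose mu := measure_function_pushforward__canonical__measure_function_Measure
  (@lebesgue_measure R) mf.
apply/esym/(@lebesgue_measure_unique R mu) => // _ [[x y] _ <-].
rewrite /mu /= /pushforward.
rewrite (_ : _ @^-1` _ = [set` `]x - a, y - a]]); last first.
  apply/seteqP; split => z /=; rewrite !in_itv/= ltrBlDr lerBrDr//.
by rewrite !lebesgue_measure_itv/= !lte_fin ltrD2r -!EFinD opprB addrA subrK.
Qed.

Definition tadd (R : realType) m (v t : m.-tuple R) : m.-tuple R :=
  [tuple tnth t i + tnth v i | i < m].

Lemma measurable_tadd (R : realType) m (v : m.-tuple R) :
  measurable_fun setT (tadd v).
Proof.
apply/measurable_fun_tnthP => i.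
rewrite (_ : _ \o _ = (fun t : m.-tuple R => tnth t i + tnth v i)); last first.
  by apply/funext => t /=; rewrite tnth_mktuple.
apply: measurable_funD; last exact: measurable_cst.
exact: measurable_tnth.
Qed.

Lemma measurable_tcons (R : realType) m : measurable_fun setT (@tcons R m).
Proof. exact: (@measurable_cons _ _ _ R fst _ snd). Qed.

(** A translation acts on the head and on the tail separately, so the translated product measure has
    the right value on measurable rectangles, which determines it. *)
Lemma lebesgue_tuple_translate (R : realType) m (v : m.-tuple R)
    (A : set (m.-tuple R)) : measurable A ->
  lebesgue_tuple R m (tadd v @^-1` A) = lebesgue_tuple R m A.
Proof.
elim: m v A => [|m IH] v A mA.
  congr (lebesgue_tuple R 0 _); apply/funext => t.
  by rewrite /preimage /= [tadd v t]tuple0 [t]tuple0.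
rewrite /lebesgue_tuple -/lebesgue_tuple /= /lebesgue_step.
pose f (p : measurableTypeR R * m.-tuple R) : measurableTypeR R * m.-tuple R :=
  (p.1 + thead v, tadd [tuple of behead v] p.2).
have mf : measurable_fun setT f.
  apply: measurable_fun_pair.
    apply: measurable_funD; last exact: measurable_cst.
    exact: measurable_fst.
  by apply: measurableT_comp; [exact: measurable_tadd|exact: measurable_snd].
pose mu := measure_function_pushforward__canonical__measure_function_Measure
  (lebesgue_measure \x lebesgue_tuple R m)%E mf.
have mA' := measurable_preimageT (@measurable_tcons R m) mA.
transitivity (mu (@tcons R m @^-1` A)).
  rewrite /mu /= /pushforward; congr (_ _); apply/seteqP.
  suff E x : tadd v (tcons x) = tcons (f x) by split => x /=; rewrite /preimage/= E.
  apply: eq_from_tnth => i; rewrite tnth_mktuple.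
  have [j ->|->] := unliftP ord0 i; last by rewrite !tnth0.
  rewrite !tnthS tnth_mktuple tnth_behead; congr (_ + tnth v _).
  by apply/val_inj; rewrite /= inordK// ltnS.
apply/esym/product_measure_unique => // B C mB mC; rewrite /mu /= /pushforward.
rewrite (_ : f @^-1` _ = ((fun x => x + thead v) @^-1` B) `*` (tadd [tuple of behead v] @^-1` C))//.
rewrite product_measure1E; last first.
- exact: measurable_preimageT (measurable_tadd _) mC.
- apply: measurable_preimageT mB.
  apply: measurable_funD; last exact: measurable_cst.
  exact: measurable_id.
by rewrite IH//; congr (_ * _)%E; exact: lebesgue_measure_translate.
Qed.

Definition rowt (R : realType) m (t : m.-tuple R) : 'rV[R]_m := \row_i tnth t i.

(** Measurability is borrowed from tuples, whose product sigma-algebra is the one on which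
    [lebesgue_rV] is built. *)
Definition measurable_rV (R : realType) m (A : set 'rV[R]_m) :=
  measurable [set t : m.-tuple R | A (rowt t)].

Definition coord_measurable d (T : measurableType d) (R : realType) m
    (f : T -> 'rV[R]_m) :=
  forall i, measurable_fun setT (fun x => f x 0 i).

Lemma measurable_rV_comp d (T : measurableType d) (R : realType) m
    (f : T -> 'rV[R]_m) (A : set 'rV[R]_m) :
  coord_measurable f -> measurable_rV A -> measurable [set x | A (f x)].
Proof.
move=> mf mA.
have mg : measurable_fun setT (fun x => [tuple f x 0 i | i < m]).
  apply/measurable_fun_tnthP => i.
  rewrite (_ : _ \o _ = fun x => f x 0 i); first exact: mf.
  by apply/funext => x /=; rewrite tnth_mktuple.
rewrite (_ : [set _ | _] = (fun x => [tuple f x 0 i | i < m]) @^-1`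
    [set t : m.-tuple R | A (rowt t)]); first exact: measurable_preimageT mg mA.
apply/funext => x /=; congr (A _); apply/rowP => i.
by rewrite mxE tnth_mktuple.
Qed.

Section coord_measurable_theory.
Context d (T : measurableType d) (R : realType).

Lemma coord_measurable_cst m (v : 'rV[R]_m) : coord_measurable (fun _ : T => v).
Proof. by move=> i; exact: measurable_cst. Qed.

Lemma coord_measurableD m (f g : T -> 'rV[R]_m) :
  coord_measurable f -> coord_measurable g -> coord_measurable (fun x => f x + g x).
Proof.
move=> mf mg i; under eq_fun do rewrite mxE.
by apply: measurable_funD; [exact: mf|exact: mg].
Qed.

Lemma coord_measurable_mulmx m p (f : T -> 'rV[R]_m) (M : 'M[R]_(m, p)) :
  coord_measurable f -> coord_measurable (fun x => f x *m M).
Proof.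
move=> mf i; under eq_fun do rewrite mxE.
by apply: measurable_sum => j; apply: measurable_funM; [exact: mf|exact: measurable_cst].
Qed.

Lemma coord_measurableN m (f : T -> 'rV[R]_m) :
  coord_measurable f -> coord_measurable (fun x => - f x).
Proof.
move=> mf; rewrite (_ : (fun x => - f x) = fun x => f x *m - 1%:M).
  exact: coord_measurable_mulmx.
by apply/funext => x; rewrite mulmxN mulmx1.
Qed.

Lemma coord_measurable_rowt m (f : T -> m.-tuple R) :
  measurable_fun setT f -> coord_measurable (fun x => rowt (f x)).
Proof.
move=> mf i; under eq_fun do rewrite mxE.
by move/measurable_fun_tnthP : mf => /(_ i).
Qed.

End coord_measurable_theory.

Lemma le_lebesgue_rV (R : realType) m (A B : set 'rV[R]_m) :
  A `<=` B -> (lebesgue_rV A <= lebesgue_rV B)%E.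
Proof. by move=> AB; apply: le_lebesgue_tuple => t; exact: AB. Qed.

Lemma lebesgue_rV_ge0 (R : realType) m (A : set 'rV[R]_m) : (0 <= lebesgue_rV A)%E.
Proof. exact: measure_ge0. Qed.

Lemma lebesgue_rV0 (R : realType) m : lebesgue_rV (@set0 'rV[R]_m) = 0%E.
Proof. exact: measure0. Qed.

Lemma lebesgue_rV_translate (R : realType) m (v : 'rV[R]_m) (A : set 'rV[R]_m) :
  measurable_rV A -> lebesgue_rV [set x | A (x + v)] = lebesgue_rV A.
Proof.
move=> mA; rewrite /lebesgue_rV -[RHS](lebesgue_tuple_translate [tuple v 0 i | i < m])//.
congr (_ _); apply/funext => t /=; rewrite /preimage /=; congr (A _).
by apply/rowP => i; rewrite !mxE !tnth_mktuple.
Qed.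

(** Both iterated integrals are product measures of the same set, and these agree because they agree
    on rectangles. *)
Lemma lebesgue_rV_fubini (R : realType) m p (G : 'rV[R]_m -> 'rV[R]_p -> Prop) :
  measurable [set q : m.-tuple R * p.-tuple R | G (rowt q.1) (rowt q.2)] ->
  (\int[lebesgue_tuple R m]_x lebesgue_rV (G (rowt x)) =
   \int[lebesgue_tuple R p]_y lebesgue_rV (fun x => G x (rowt y)))%E.
Proof.
set H := [set q | _] => mH.
transitivity ((lebesgue_tuple R m \x lebesgue_tuple R p)%E H).
  apply: eq_integral => x _; rewrite /lebesgue_rV /=; congr (_ _).
  by apply/seteqP; split => y; rewrite /xsection /= !inE.
transitivity ((lebesgue_tuple R m \x^ lebesgue_tuple R p)%E H); last first.
  apply: eq_integral => x _; rewrite /lebesgue_rV /=; congr (_ _).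
  by apply/seteqP; split => y; rewrite /ysection /= !inE.
by apply: product_measure_unique => //= B C mB mC; rewrite product_measure2E.
Qed.

Lemma integral_lebesgue_rV_indic (R : realType) m (A : set 'rV[R]_m)
    (f : 'rV[R]_m -> \bar R) (c : \bar R) :
  measurable_rV A -> (0 <= c)%E -> (forall x, A x -> f x = c) ->
  (forall x, ~ A x -> f x = 0%E) ->
  (\int[lebesgue_tuple R m]_x f (rowt x) = lebesgue_rV A * c)%E.
Proof.
move=> mA c0 fA fNA; set B := [set t : m.-tuple R | A (rowt t)].
rewrite (eq_integral (fun x => ((\1_B x)%:E * c)%E)).
  rewrite ge0_integralZr//; first by rewrite integral_indic// setIT.
  by apply/measurable_EFinP; exact: measurable_indic.
move=> x _; rewrite indicE.
by have [/set_mem/fA ->|/negP xB] := boolP (x \in B);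
  rewrite ?mul1e// mul0e fNA// => /mem_set.
Qed.

(** This is the classical uniqueness argument for invariant measures: the volume of one set of pairs
    is computed in two ways. With the unit cube as [Q] it makes the ratio of the volumes before and
    after [M] independent of [A]. *)
Lemma lebesgue_rV_mulmx_swap (R : realType) m (M : 'M[R]_m) (A Q : set 'rV[R]_m) :
  M \in unitmx -> measurable_rV A -> measurable_rV Q ->
  (lebesgue_rV [set x | A (x *m M)] * lebesgue_rV Q =
   lebesgue_rV [set x | Q (x *m M)] * lebesgue_rV [set x | A (- x)%R])%E.
Proof.
move=> uM mA mQ.
have mlin (B : set 'rV[R]_m) : measurable_rV B -> measurable_rV [set x | B (x *m M)].
  by move=> mB; apply: measurable_rV_comp mB; exact/coord_measurable_mulmx/coord_measurable_rowt.
have mN : measurable_rV [set x | A (- x)].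
  by apply: measurable_rV_comp mA; exact/coord_measurableN/coord_measurable_rowt.
(* [G'] arises from [G] by replacing x with x - y M^-1, a translation for each fixed y. In both
   cases the section at a fixed x is a translate of [Q] or of -[A], or is empty. *)
pose G (x y : 'rV[R]_m) := A (x *m M) /\ Q (y + x *m M).
pose G' (x y : 'rV[R]_m) := A (x *m M - y) /\ Q (x *m M).
have m1 : coord_measurable (fun q : m.-tuple R * m.-tuple R => rowt q.1 *m M).
  by apply/coord_measurable_mulmx/coord_measurable_rowt; exact: measurable_fst.
have m2 : coord_measurable (fun q : m.-tuple R * m.-tuple R => rowt q.2).
  by apply/coord_measurable_rowt; exact: measurable_snd.
have -> : (lebesgue_rV [set x | A (x *m M)] * lebesgue_rV Q =
    \int[lebesgue_tuple R m]_x lebesgue_rV (G (rowt x)))%E.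
  apply/esym/(@integral_lebesgue_rV_indic _ _ _ (fun x => lebesgue_rV (G x))).
  - exact: mlin.
  - exact: lebesgue_rV_ge0.
  - move=> x Ax; rewrite -(lebesgue_rV_translate (x *m M) mQ); congr lebesgue_rV.
    by apply/seteqP; split => y => [[]|].
  - move=> x Ax; rewrite -[RHS](lebesgue_rV0 R m); congr lebesgue_rV.
    by apply/seteqP; split => y => [[]|].
have -> : (lebesgue_rV [set x | Q (x *m M)] * lebesgue_rV [set x | A (- x)%R] =
    \int[lebesgue_tuple R m]_x lebesgue_rV (G' (rowt x)))%E.
  apply/esym/(@integral_lebesgue_rV_indic _ _ _ (fun x => lebesgue_rV (G' x))).
  - exact: mlin.
  - exact: lebesgue_rV_ge0.
  - move=> x Qx; rewrite -(lebesgue_rV_translate (- (x *m M)) mN).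
    congr lebesgue_rV; apply/seteqP; split => y; rewrite /= opprD opprK addrC.
      by case.
    by split.
  - move=> x Qx; rewrite -[RHS](lebesgue_rV0 R m); congr lebesgue_rV.
    by apply/seteqP; split => y => [[]|].
rewrite !lebesgue_rV_fubini.
- apply: eq_integral => y _; set v := rowt y.
  rewrite -(@lebesgue_rV_translate _ _ (- (v *m invmx M)) [set x | G x v]).
    congr lebesgue_rV; apply/funext => x; rewrite /= /G /G'.
    by rewrite mulmxDl mulNmx mulmxKV// addrCA subrr addr0.
  apply: measurableI.
    exact: mlin.
  apply: measurable_rV_comp mQ; apply: coord_measurableD; first exact: coord_measurable_cst.
  exact/coord_measurable_mulmx/coord_measurable_rowt.
- apply: measurableI.
    by apply: measurable_rV_comp mA; apply: coord_measurableD => //; exact: coord_measurableN.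
  exact: measurable_rV_comp mQ.
- apply: measurableI; first exact: measurable_rV_comp mA.
  by apply: measurable_rV_comp mQ; exact: coord_measurableD.
Qed.

(** * Boxes and their volume *)

Definition box (R : realType) m (a b : R) : set 'rV[R]_m :=
  [set x | forall i, a <= x 0 i <= b].
Arguments box {R} m a b _.

Lemma measurable_forall d (T : measurableType d) (I : finType) (P : I -> T -> Prop) :
  (forall i, measurable [set t | P i t]) -> measurable [set t | forall i, P i t].
Proof.
move=> mP; rewrite (_ : mkset _ = \bigcap_(i in [set: I]) [set t | P i t]).
  by apply: fin_bigcap_measurable => // i _; exact: mP.
by apply/seteqP; split => t h i *; exact: h.
Qed.

Lemma measurable_box (R : realType) m (a b : R) : measurable_rV (box m a b).
Proof.
apply: measurable_forall => i.
rewrite (_ : mkset _ = (fun t : m.-tuple R => tnth t i) @^-1` [set` `[a, b]]).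
  exact: (measurable_preimageT (@measurable_tnth _ R m i)).
by apply/funext => t; rewrite /= mxE in_itv.
Qed.

Arguments measurable_box R m a b : clear implicits.

Lemma lebesgue_box (R : realType) m (a b : R) : a <= b ->
  lebesgue_rV (box m a b) = ((b - a) ^+ m)%:E.
Proof.
move=> ab; rewrite /lebesgue_rV.
rewrite (_ : mkset _ = [set t | forall i : 'I_m, [set` `[a, b]] (tnth t i)]).
  rewrite (@lebesgue_tuple_box R m (fun _ => [set` `[a, b]]))//.
  rewrite (eq_bigr (fun=> (b - a)%:E)) => [|i _].
    by rewrite prodEFin big_const_ord iter_mulr_1.
  rewrite lebesgue_measure_itv/= lte_fin -EFinB.
  by move: ab; rewrite le_eqVlt => /predU1P[->|->//]; rewrite ltxx subrr.
by apply/funext => t; apply/propext; split => h i; have := h i; rewrite /= mxE in_itv.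
Qed.

Lemma measurable_rV_mulmx (R : realType) m p (M : 'M[R]_(m, p)) (A : set 'rV[R]_p) :
  measurable_rV A -> measurable_rV [set x | A (x *m M)].
Proof.
by move=> mA; apply: measurable_rV_comp mA; exact/coord_measurable_mulmx/coord_measurable_rowt.
Qed.

(** For invertible [M] this is 1 / |det M|, since [[set x | A (x *m M)]] is a preimage under [M]. *)
Definition volume_factor (R : realType) m (M : 'M[R]_m) : R :=
  fine (lebesgue_rV [set x | box m 0 1 (x *m M)]).

(** * Scaling of volume under invertible matrices *)

Section volume_factor_theory.
Context (R : realType) (m : nat).
Implicit Types (M P : 'M[R]_m) (A : set 'rV[R]_m).

Let cube : set 'rV[R]_m := box m 0 1.

Let cube1 : lebesgue_rV cube = 1%E.
Proof. by rewrite lebesgue_box// subr0 expr1n. Qed.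

(** This is the swap identity for the identity matrix and the cube; it removes the reflection from
    the general case. *)
Let lebesgue_rVN A : measurable_rV A -> lebesgue_rV [set x | A (- x)] = lebesgue_rV A.
Proof.
move=> mA; have := lebesgue_rV_mulmx_swap (unitmx1 R m) mA (measurable_box R m 0 1).
rewrite -/cube cube1 mule1 (_ : [set x | cube _] = cube); last first.
  by apply/funext => x /=; rewrite mulmx1.
rewrite cube1 mul1e => <-; congr lebesgue_rV.
by apply/funext => x /=; rewrite mulmx1.
Qed.

Let ext_mulmx M A : M \in unitmx -> measurable_rV A ->
  lebesgue_rV [set x | A (x *m M)] =
  (lebesgue_rV A * lebesgue_rV [set x | cube (x *m M)])%E.
Proof.
move=> uM mA; have := lebesgue_rV_mulmx_swap uM mA (measurable_box R m 0 1).
by rewrite cube1 mule1 lebesgue_rVN// muleC.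
Qed.

Let ext_mul1 M : M \in unitmx ->
  (lebesgue_rV [set x | cube (x *m M)] *
   lebesgue_rV [set x | cube (x *m invmx M)] = 1)%E.
Proof.
move=> uM; rewrite -ext_mulmx ?unitmx_inv//; last first.
  exact: measurable_rV_mulmx (measurable_box R m 0 1).
by rewrite -[RHS]cube1; congr lebesgue_rV; apply/funext => x /=; rewrite mulmxKV.
Qed.

(** An infinite volume times the nonnegative volume belonging to the inverse would be 0 or infinite,
    whereas the product is 1. *)
Let ext_fin M : M \in unitmx -> lebesgue_rV [set x | cube (x *m M)] = (volume_factor M)%:E.
Proof.
move=> uM; rewrite /volume_factor -/cube; have := ext_mul1 uM.
have := lebesgue_rV_ge0 [set x | cube (x *m M)].
have := lebesgue_rV_ge0 [set x | cube (x *m invmx M)].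
 move: (lebesgue_rV _) (lebesgue_rV _).  move=> [s||] r //. 
rewrite le_eqVlt => /predU1P[<- _|r0 _]; last by rewrite gt0_mulye.
by rewrite mule0 => /eqP; rewrite eq_sym onee_eq0.
Qed.

Lemma lebesgue_rV_mulmx M A : M \in unitmx -> measurable_rV A ->
  lebesgue_rV [set x | A (x *m M)] = (lebesgue_rV A * (volume_factor M)%:E)%E.
Proof. by move=> uM mA; rewrite ext_mulmx// ext_fin. Qed.

Lemma volume_factorM M P : M \in unitmx -> P \in unitmx ->
  volume_factor (M *m P) = volume_factor M * volume_factor P.
Proof.
move=> uM uP; apply: EFin_inj; rewrite -ext_fin ?unitmx_mul ?uM// EFinM.
have := lebesgue_rV_mulmx uM (measurable_rV_mulmx P (measurable_box R m 0 1)).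
rewrite -/cube ext_fin// muleC => <-; congr lebesgue_rV.
by apply/funext => x /=; rewrite mulmxA.
Qed.

Lemma volume_factor_ge0 M : 0 <= volume_factor M.
Proof. by apply: fine_ge0; exact: lebesgue_rV_ge0. Qed.

Lemma volume_factor_scalar (r : R) : 0 < r ->
  volume_factor (r%:M : 'M[R]_m) = r ^- m.
Proof.
move=> r0; rewrite /volume_factor -/cube.
rewrite (_ : [set x | _] = box m 0 r^-1); first by rewrite lebesgue_box ?invr_ge0 ?ltW// subr0 exprVn.
apply/funext => x; apply/propext; split => h i; have := h i;
  by rewrite mul_mx_scalar mxE pmulr_rge0// -ler_pdivlMl// mulr1.
Qed.

Lemma volume_factor1 : volume_factor (1%:M : 'M[R]_m) = 1.
Proof. by rewrite volume_factor_scalar// expr1n invr1. Qed.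

Lemma volume_factor_gt0 M : M \in unitmx -> 0 < volume_factor M.
Proof.
move=> uM; rewrite lt_neqAle volume_factor_ge0 andbT eq_sym.
apply/eqP => M0; have := volume_factor1.
by rewrite -(mulmxV uM) volume_factorM ?unitmx_inv// M0 mul0r => /eqP; rewrite eq_sym oner_eq0.
Qed.

Lemma volume_factorV M : M \in unitmx ->
  volume_factor (invmx M) = (volume_factor M)^-1.
Proof.
move=> uM; apply: (mulfI (lt0r_neq0 (volume_factor_gt0 uM))).
by rewrite -volume_factorM ?unitmx_inv// mulmxV// volume_factor1 mulfV// lt0r_neq0// volume_factor_gt0.
Qed.

(* The diagonal involution with entry -1 in place j conjugates the shear to its inverse. *)
Lemma volume_factor_shear (j : 'I_m) (c : 'cV[R]_m) : c j 0 = 0 ->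
  (1%:M + c *m delta_mx 0 j \in unitmx) /\ volume_factor (1%:M + c *m delta_mx 0 j) = 1.
Proof.
move=> cj; set e : 'rV[R]_m := delta_mx 0 j; set S := 1%:M + _.
pose D : 'M[R]_m := diag_mx (\row_k (-1) ^+ (k == j)).
have eD : e *m D = - e.
  by apply/rowP => k; rewrite mul_mx_diag !mxE eqxx /=; case: eqP; rewrite /= ?expr1 ?mul1r ?mul0r ?oppr0.
have Dc : D *m c = c.
  by apply/colP => k; rewrite mul_diag_mx !mxE; case: eqP => [->|_]; rewrite ?cj ?mulr0 ?expr0 ?mul1r.
have ec : e *m c = 0.
  apply/rowP => k; rewrite !mxE (bigD1 j)//= big1 => [|i ij]; rewrite !mxE !eqxx ?(negbTE ij) ?mul0r//.
  by rewrite ord1 cj mulr0 addr0.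
have DD : D *m D = 1%:M.
  apply/matrixP => i k; rewrite mul_mx_diag !mxE.
  have [->|] := eqVneq i k; last by rewrite mul0r.
  by rewrite !mulr1n -expr2 -exprM mulnC exprM sqrrN expr1n expr1n.
have DSD : D *m S *m D = 1%:M - c *m e.
  by rewrite /S mulmxDr mulmx1 mulmxDl DD mulmxA Dc -mulmxA eD mulmxN.
have SS : S *m (D *m S *m D) = 1%:M.
  rewrite DSD /S mulmxDl mul1mx mulmxBr mulmx1 [c *m e *m _]mulmxA -[c *m e *m c]mulmxA ec mulmx0 mul0mx subr0.
  by rewrite subrK.
have [uS _] := mulmx1_unit SS; have [uD _] := mulmx1_unit DD.
have fDD : volume_factor D * volume_factor D = 1 by rewrite -volume_factorM// DD volume_factor1.
split; first exact: uS.
have := volume_factor1; rewrite -SS !volume_factorM ?unitmx_mul ?uD ?uS//.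
rewrite [X in _ * X]mulrAC fDD mul1r -expr2 => /eqP.
by rewrite sqrp_eq1 ?volume_factor_ge0// => /eqP.
Qed.

End volume_factor_theory.

(** * Truncated cones *)

Definition row_behead (R : realType) n (y : 'rV[R]_n.+1) : 'rV[R]_n :=
  \row_j y 0 (lift ord0 j).

(** The cone over the copy of [A] at height 1, cut to heights between 1/2 and 1. Bounding the
    heights away from 0 makes its (n+1)-volume comparable to the n-volume of [A]. *)
Definition truncated_cone (R : realType) n (A : set 'rV[R]_n) : set 'rV[R]_n.+1 :=
  [set y : 'rV[R]_n.+1 | 2^-1 <= y 0 0 <= 1 /\ A ((y 0 0)^-1 *: row_behead y)].

Section truncated_cone_volume.
Context (R : realType) (n : nat) (A : set 'rV[R]_n).
Hypothesis mA : measurable_rV A.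

Let I : set (measurableTypeR R) := [set` `[2^-1, 1]].

Let section_cone (x : R) := lebesgue_rV [set z | (2^-1 <= x <= 1) /\ A (x^-1 *: z)].

Let lebesgue_truncated_cone :
  lebesgue_rV (truncated_cone A) = (\int[lebesgue_measure]_x section_cone x)%E.
Proof.
rewrite /lebesgue_rV [LHS]/(lebesgue_step _ _) /pushforward /product_measure1.
apply: eq_integral => x _; rewrite /section_cone /lebesgue_rV /=; congr (_ _).
have E0 t : (rowt (tcons (x, t)) : 'rV[R]_n.+1) 0 0 = x by rewrite mxE tnth0.
have Eb t : row_behead (rowt (tcons (x, t))) = rowt t.
  by apply/rowP => i; rewrite !mxE tnthS.
by apply/funext => t; rewrite /xsection /= in_setE/= /truncated_cone /= E0 Eb.
Qed.

(** The slice at height x is x[A], and the scaling by x^-1 has volume factor x^n. *)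
Let section_coneE (x : R) : section_cone x =
  ((\1_I x)%:E * (lebesgue_rV A * (x ^+ n)%:E))%E.
Proof.
rewrite /section_cone indicE; have [/set_mem|/negP xI] := boolP (x \in I).
  rewrite /I /= in_itv/= => xI; have x0 : 0 < x.
    by case/andP: xI => + _; apply: lt_le_trans.
  rewrite mul1e -[X in (X%:E)%E]invrK -exprVn -volume_factor_scalar ?invr_gt0//.
  rewrite -lebesgue_rV_mulmx//; last by rewrite unitmxE det_scalar unitfE expf_neq0// invr_neq0// gt_eqF.
  congr lebesgue_rV; apply/funext => z /=; rewrite mul_mx_scalar xI.
  by apply/propext; split => [[]|].
rewrite mul0e -(lebesgue_rV0 R n); congr lebesgue_rV.
apply/seteqP; split => z //= [xx]; exfalso.
by apply: xI; rewrite inE /I /= in_itv.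
Qed.

Let integral_I (c : \bar R) : (0 <= c)%E ->
  (\int[lebesgue_measure]_x ((\1_I x)%:E * c) = 2^-1%:E * c)%E.
Proof.
move=> c0; have mI : measurable I by exact: measurable_itv.
rewrite ge0_integralZr//; last first.
  by apply/measurable_EFinP; exact: measurable_indic.
congr (_ * _)%E; rewrite integral_indic// setIT.
transitivity (lebesgue_measure ([set` `[2^-1, 1]] : set R)) => //.
rewrite lebesgue_measure_itv/= lte_fin.
rewrite invf_lt1// ltr1n -EFinB; congr (_%:E).
by rewrite [X in X - _](splitr 1) mul1r addrK.
Qed.

Lemma lebesgue_truncated_cone_le : (lebesgue_rV (truncated_cone A) <= lebesgue_rV A)%E.
Proof.
have A0 := lebesgue_rV_ge0 A.
rewrite lebesgue_truncated_cone (@le_trans _ _ (2^-1%:E * lebesgue_rV A)%E)//.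
  rewrite -integral_I//; apply: le_ge0_integral => x; first exact: lebesgue_rV_ge0.
  rewrite section_coneE indicE.
  have [/set_mem|] := boolP (x \in I); last by rewrite !mul0e.
  rewrite /I /= in_itv/= => /andP[x2 x1].
  by rewrite !mul1e muleC gee_pMl// lee_fin exprn_ile1// (le_trans _ x2).
by rewrite gee_pMl// lee_fin invf_le1// ler1n.
Qed.

(** The factor x^n is at least 2^-n at these heights; the remaining 1/2 is the length of the
    interval of heights. *)
Lemma lebesgue_truncated_cone_ge :
  ((2^-1 ^+ n.+1)%:E * lebesgue_rV A <= lebesgue_rV (truncated_cone A))%E.
Proof.
have A0 := lebesgue_rV_ge0 A.
rewrite lebesgue_truncated_cone exprS EFinM -muleA -integral_I; last by rewrite mule_ge0// lee_fin.
apply: le_ge0_integral => x; first by rewrite !mule_ge0// lee_fin//.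
rewrite section_coneE indicE.
have [/set_mem|] := boolP (x \in I); last by rewrite !mul0e.
rewrite /I /= in_itv/= => /andP[x2 _].
rewrite !mul1e muleC lee_wpmul2l// lee_fin lerXn2r// nnegrE//.
by apply: le_trans x2.
Qed.

End truncated_cone_volume.

(** * The body of a basis *)

Definition linform (R : realType) m (w : 'cV[R]_m) (v : 'rV[R]_m) : R := (v *m w) 0 0.

Section linform_theory.
Context (R : realType) (m : nat) (w : 'cV[R]_m).

Lemma linformD u v : linform w (u + v) = linform w u + linform w v.
Proof. by rewrite /linform mulmxDl mxE. Qed.

Lemma linformZ a v : linform w (a *: v) = a * linform w v.
Proof. by rewrite /linform -scalemxAl mxE. Qed.

Lemma linform0 : linform w 0 = 0.
Proof. by rewrite /linform mul0mx mxE. Qed.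

Lemma linform_sum (I : Type) (r : seq I) (P : pred I) (f : I -> 'rV[R]_m) :
  linform w (\sum_(i <- r | P i) f i) = \sum_(i <- r | P i) linform w (f i).
Proof. exact: (big_morph _ linformD linform0). Qed.

End linform_theory.

(** It turns the sum over pairs in the definition of [body] into an unrestricted double sum, which
    splits into products. *)
Lemma sum_pairs (V : zmodType) n (g : 'I_n -> 'I_n -> V) :
  (forall i j, g i j = g j i) ->
  (\sum_(i < n) \sum_(j < n | (i < j)%N) g i j) *+ 2 = \sum_i \sum_j g i j - \sum_i g i i.
Proof.
move=> gC; apply/eqP; rewrite eq_sym subr_eq; apply/eqP.
rewrite (eq_bigr (fun i : 'I_n => \sum_(j < n | (i < j)%N) g i j + \sum_(j < n | (j < i)%N) g i j + g i i)).
  rewrite !big_split /=; congr (_ + _).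
  rewrite mulr2n; congr (_ + _).
  rewrite (exchange_big_dep xpredT)//=.
  by apply: eq_bigr => i _; apply: eq_bigr => j _; rewrite gC.
move=> i _; rewrite (bigD1 i)//= addrC; congr (_ + _).
rewrite (bigID (fun j : 'I_n => (i < j)%N))/=; congr (_ + _); apply: eq_bigl => j.
  by case: ltngtP => //; rewrite ?andbF// ?andbT => ij; apply/eqP => ji; rewrite ji ltnn in ij.
case: (ltngtP j i) => [ij|ij|/val_inj ->]; rewrite ?eqxx ?andbF ?andbT//.
by apply/eqP => ji; rewrite ji ltnn in ij.
Qed.

Definition basis_mx (R : realType) n (B : n.+1.-tuple 'rV[R]_n.+1) : 'M[R]_n.+1 :=
  \matrix_i tnth B i.

Lemma mul_basis_mx (R : realType) n (B : n.+1.-tuple 'rV[R]_n.+1) t :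
  t *m basis_mx B = \sum_i t 0 i *: tnth B i.
Proof. by rewrite mulmx_sum_row; apply: eq_bigr => i _; rewrite rowK. Qed.

Lemma dir_eq (R : realType) n (u v : 'rV[R]_n.+1) : u != 0 -> v != 0 ->
  dir u = dir v -> exists k, u = k *: v.
Proof.
move=> u0 v0 /(congr1 val); rewrite !val_dir// => uv.
by apply/vlineP; rewrite -uv memv_line.
Qed.

Lemma dirZ (R : realType) n (k : R) (v : 'rV[R]_n.+1) : k != 0 ->
  dir (k *: v) = dir v.
Proof.
move=> k0; have [->|v0] := eqVneq v 0; first by rewrite scaler0.
apply/val_inj; rewrite !val_dir ?scaler_eq0 ?negb_or ?k0//.
apply/eqP; rewrite eqEdim !dim_vline scaler_eq0 negb_or k0 v0 andbT.
by rewrite -memvE memvZ// memv_line.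
Qed.

Section body.
Context (R : realType) (n : nat) (B : n.+1.-tuple 'rV[R]_n.+1) (w : 'cV[R]_n.+1).
Let x i := linform w (tnth B i).
Let X := \sum_i x i.
Hypothesis x_gt0 : forall i, 0 < x i.

(** If u is the combination of the vertices with coefficients of total [S], each vertex contributes
    at least X / K to the form, so S X <= K l(u), while no coordinate of u exceeds [S]. The
    direction fixes v only up to a scalar of either sign, whence the absolute values. *)
Lemma body_coord_le (K : R) : 0 < K -> (forall k l, k != l -> X <= K * (x k + x l)) ->
  forall v, v != 0 -> body B (dir v) ->
  exists2 t, v = t *m basis_mx B & forall i, `|t 0 i| <= K * `|linform w v| / X.
Proof.
move=> K0 XK v v0 [s [s0 [i1 [j1 [ij1 sij1]]] vs]].
have X0 : 0 < X.
  by rewrite /X big_ord_recl ltr_wpDr// sumr_ge0// => i _; exact: ltW.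
pose S := \sum_(i < n.+1) \sum_(j < n.+1 | (i < j)%N) s i j.
pose u := \sum_(i < n.+1) \sum_(j < n.+1 | (i < j)%N) s i j *: (tnth B i + tnth B j).
have Su : S * X <= K * linform w u.
  rewrite /u linform_sum mulr_suml mulr_sumr ler_sum// => i _.
  rewrite linform_sum mulr_suml mulr_sumr ler_sum// => j ij.
  rewrite linformZ linformD mulrCA ler_wpM2l ?s0//.
  by apply: XK; apply: contraTneq ij => ->; rewrite ltnn.
have S0 : 0 < S.
  have ss (i : 'I_n.+1) : 0 <= \sum_(j < n.+1 | (i < j)%N) s i j.
    by apply: sumr_ge0 => j ij; exact: s0.
  rewrite /S (bigD1 i1)//= ltr_wpDr//; first by rewrite sumr_ge0.
  rewrite (bigD1 j1)//= ltr_wpDr//; first by rewrite sumr_ge0// => j /andP[]; auto.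
  by rewrite lt_neqAle eq_sym sij1 s0.
have u0 : u != 0.
  apply/eqP => u0; move: Su; rewrite u0 linform0 mulr0 leNgt => /negP; apply.
  exact: mulr_gt0.
have [k vk] := dir_eq v0 u0 vs.
pose t : 'rV[R]_n.+1 := \row_m \sum_(i < n.+1) \sum_(j < n.+1 | (i < j)%N) s i j * ((i == m)%:R + (j == m)%:R).
have ut : u = t *m basis_mx B.
  rewrite mul_basis_mx; under [RHS]eq_bigr do rewrite mxE scaler_suml.
  rewrite exchange_big; apply: eq_bigr => i _ /=.
  under [RHS]eq_bigr do rewrite scaler_suml.
  rewrite exchange_big /=.
  apply: eq_bigr => j ij; under [RHS]eq_bigr do rewrite -scalerA.
  rewrite -scaler_sumr; congr (_ *: _); under [RHS]eq_bigr do rewrite scalerDl.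
  rewrite big_split /=; congr (_ + _).
    by rewrite (bigD1 i)//= eqxx scale1r big1 ?addr0// => m mi; rewrite eq_sym (negbTE mi) scale0r.
  by rewrite (bigD1 j)//= eqxx scale1r big1 ?addr0// => m mi; rewrite eq_sym (negbTE mi) scale0r.
(* A pair i < j contains the index m at most once, so each coefficient is counted at most once in
   coordinate m. *)
have t0 m : 0 <= t 0 m <= S.
  rewrite mxE /S; apply/andP; split.
    apply: sumr_ge0 => i _; apply: sumr_ge0 => j ij.
    by rewrite mulr_ge0 ?s0// addr_ge0.
  apply: ler_sum => i _; apply: ler_sum => j ij.
  rewrite ler_piMr ?s0//; have [<-|_] := eqVneq i m; last by rewrite add0r lern1 leq_b1.
  by rewrite -val_eqE /= gtn_eqF// addr0.
exists (k *: t); first by rewrite vk ut scalemxAl.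
move=> i; rewrite mxE normrM vk linformZ normrM -!mulrA [K * _]mulrCA.
rewrite ler_wpM2l//; have /andP[ti0 tiS] := t0 i.
rewrite ger0_norm// (le_trans tiS)// mulrA ler_pdivlMr// (le_trans Su)//.
by apply: ler_wpM2l; [exact: ltW|exact: ler_norm].
Qed.

(** With coefficients of the form a_i + a_j on the pairs, coordinate i of the combination is (n-1)
    a_i + sum a. Equating it to t_i and summing gives sum a = (sum t) / 2n, then a_i; the hypothesis
    on t says precisely that a_i >= 0. *)
Lemma body_inner (t : 'rV[R]_n.+1) : (2 <= n)%N -> (forall i, 0 < t 0 i) ->
  (forall i, \sum_j t 0 j <= (2 * n)%:R * t 0 i) ->
  body B (dir (t *m basis_mx B)).
Proof.
move=> n2 t0 tS.
have n0 : 0 < (2 * n)%:R :> R by rewrite ltr0n muln_gt0 (leq_trans _ n2).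
have n1 : 0 < n%:R - 1 :> R by rewrite subr_gt0 ltr1n.
have n10 := lt0r_neq0 n1; have n20 := lt0r_neq0 n0.
pose S := (\sum_j t 0 j) / (2 * n)%:R.
have S0 : 0 < S.
  by rewrite divr_gt0// big_ord_recl ltr_wpDr// sumr_ge0// => i _; exact: ltW.
pose a i := (t 0 i - S) / (n%:R - 1).
have a0 i : 0 <= a i by rewrite divr_ge0 ?(ltW n1)// subr_ge0 ler_pdivrMr// mulrC.
have aS : \sum_i a i = S.
  rewrite -mulr_suml; apply: (mulIf n10); rewrite divfK// big_split /= sumr_const card_ord.
  have -> : \sum_j t 0 j = S * (2 * n)%:R by rewrite divfK.
  by rewrite -mulr_natr natrM -natr1; ring.
exists (fun i j => a i + a j); split.
- by move=> i j _; rewrite addr_ge0.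
(* Since the a_i sum to [S] > 0, one of them is positive; it is paired with index 0, or with index 1
   if it is itself index 0. *)
- have [i ai] : exists i, a i != 0.
    apply/existsP; rewrite -negb_forall; apply: contraTN S0 => /forallP aall.
    by rewrite -aS big1 ?ltxx// => i _; exact/eqP/aall.
  have a_gt0 : 0 < a i by rewrite lt_neqAle eq_sym ai a0.
  have [i0|i0] := posnP i.
    have n1' : (1 < n.+1)%N by rewrite ltnS (leq_trans _ n2).
    exists i, (Ordinal n1'); split; first by rewrite i0.
    by rewrite gt_eqF// ltr_wpDr.
  by exists ord0, i; split => //; rewrite gt_eqF// ltr_wpDl.
congr dir; rewrite mul_basis_mx.
pose Phi := \sum_i tnth B i.
have two : (2 : R) != 0 by rewrite pnatr_eq0.
(* Doubling makes [sum_pairs] applicable. The double sum minus its diagonal is then twice (n-1) sum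
   a_i f_i + S [Phi], where f_i are the vectors of [B]. *)
apply: (scalerI two); rewrite !scaler_nat.
rewrite (sum_pairs (g := fun i j => (a i + a j) *: (tnth B i + tnth B j))); last first.
  by move=> i j; rewrite addrC [_ + tnth B i]addrC.
have -> : \sum_i \sum_j (a i + a j) *: (tnth B i + tnth B j) =
    (n.+1%:R *: \sum_i a i *: tnth B i + S *: Phi) *+ 2.
  transitivity (\sum_i (n.+1%:R *: (a i *: tnth B i) + a i *: Phi + (S *: tnth B i + \sum_j a j *: tnth B j))).
    apply: eq_bigr => i _; under eq_bigr do rewrite scalerDl !scalerDr.
    rewrite !big_split /= sumr_const card_ord scaler_nat -scaler_sumr -scaler_suml aS.
    by [].
  rewrite !big_split /= -!scaler_sumr -scaler_suml aS sumr_const card_ord scaler_nat.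
  by rewrite mulr2n; congr (_ + _); rewrite addrC.
have -> : \sum_i (a i + a i) *: (tnth B i + tnth B i) = (2 *: \sum_i a i *: tnth B i) *+ 2.
  by rewrite scaler_sumr -sumrMnl; apply: eq_bigr => i _; rewrite -!mulr2n -[a i *+ 2]mulr_natl -scalerA !scalerMnr.
rewrite -mulrnBl; congr (_ *+ 2).
rewrite addrAC -scalerBl (_ : n.+1%:R - 2 = n%:R - 1 :> R); last by rewrite -natr1; ring.
rewrite scaler_sumr /Phi scaler_sumr -big_split /=; apply: eq_bigr => i _.
by rewrite scalerA mulrC divfK// -scalerDl subrK.
Qed.

End body.

(** * Iterated bases *)

(** The column vanishes at place j, so the left factor is a shear of the shape treated by
    [volume_factor_shear]. *)
Lemma basis_mx_step (R : realType) n (B : n.+1.-tuple 'rV[R]_n.+1) j :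
  basis_mx (basis_step B j) =
  (1%:M + (\col_i (i != j)%:R) *m delta_mx 0 j) *m basis_mx B.
Proof.
apply/row_matrixP => i; rewrite rowK tnth_mktuple mulmxDl mul1mx.
rewrite -mulmxA -rowE linearD /= rowK.
have -> : row i ((\col_k (k != j)%:R) *m row j (basis_mx B)) = (i != j)%:R *: tnth B j.
  by apply/rowP => k; rewrite !mxE big_ord1 !mxE.
by have [->|ij] := eqVneq i j; rewrite ?scale0r ?addr0// scale1r.
Qed.

Lemma basis_mx_at (R : realType) n (B : n.+1.-tuple 'rV[R]_n.+1) I :
  basis_mx B \in unitmx -> basis_mx (basis_at B I) \in unitmx /\
  volume_factor (basis_mx (basis_at B I)) = volume_factor (basis_mx B).
Proof.
rewrite /basis_at; elim: I B => [//|j I IH] B uB /=.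
pose c : 'cV[R]_n.+1 := \col_i (i != j)%:R.
have cj : c j 0 = 0 by rewrite mxE eqxx.
have [uS fS] := volume_factor_shear cj.
have uB' : basis_mx (basis_step B j) \in unitmx by rewrite basis_mx_step unitmx_mul uS.
have [-> ->] := IH _ uB'; split=> //.
by rewrite basis_mx_step volume_factorM// fS mul1r.
Qed.

Lemma basis_mx_unit (R : realType) n (B : n.+1.-tuple 'rV[R]_n.+1) :
  basis_of fullv B -> basis_mx B \in unitmx.
Proof.
move=> /basis_free freeB; rewrite -row_free_unit; apply: inj_row_free => v.
rewrite mul_basis_mx => vB; apply/rowP => i; rewrite mxE.
have /freeP := freeB; apply; rewrite -[RHS]vB.
by apply: eq_bigr => k _; rewrite (tnth_nth 0).
Qed.

(** Pairs are required because one entry may stay small forever: a step at j keeps x_j and enlarges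
    all the others. *)
Definition balanced (R : realType) m (C : R) (x : 'I_m -> R) :=
  forall i k l, k != l -> x i <= C * (x k + x l).

Lemma balanced_exists (R : realType) m (x : 'I_m -> R) : (forall i, 0 < x i) ->
  exists2 C, 1 <= C & balanced C x.
Proof.
(* The sum contains the ratio x_i / x_k, so C x_k alone dominates x_i; the summand 1 gives C >= 1,
   on which [balanced_at] relies. *)
move=> x0; exists (1 + \sum_i \sum_k x i / x k).
  by rewrite lerDl sumr_ge0// => i _; rewrite sumr_ge0// => k _; rewrite divr_ge0 ?ltW.
move=> i k l _; have xk := x0 k.
have d0 a b : 0 <= x a / x b by rewrite divr_ge0 ?ltW.
have s0 a : 0 <= \sum_b x a / x b by rewrite sumr_ge0.
have C_ge : x i / x k <= 1 + \sum_i \sum_k x i / x k.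
  rewrite (bigD1 i)//= (bigD1 k)//= ler_wpDl// -addrA lerDl addr_ge0 ?sumr_ge0//.
rewrite -[leLHS](divfK (lt0r_neq0 xk)); apply: ler_pM => //; first exact: ltW.
by rewrite lerDl ltW.
Qed.

Section basis_at_invariants.
Context (R : realType) (n : nat) (w : 'cV[R]_n.+1).
Implicit Types (B : n.+1.-tuple 'rV[R]_n.+1) (I : seq 'I_n.+1).

Let x B i := linform w (tnth B i).

Let x_step B j i : x (basis_step B j) i = if i == j then x B j else x B i + x B j.
Proof. by rewrite /x tnth_mktuple; case: eqP => // _; rewrite linformD. Qed.

Lemma basis_at_ind (P : n.+1.-tuple 'rV[R]_n.+1 -> Prop) :
  (forall B j, P B -> P (basis_step B j)) -> forall B I, P B -> P (basis_at B I).
Proof. by move=> step B I; rewrite /basis_at; elim: I B => //= j I IH B PB; exact/IH/step. Qed.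

Lemma linform_at_gt0 B I : (forall i, 0 < x B i) ->
  forall i, 0 < x (basis_at B I) i.
Proof.
apply: (@basis_at_ind (fun B => forall i, 0 < x B i)) => {}B j B0 i.
by rewrite x_step; case: eqP => // _; rewrite addr_gt0.
Qed.

(** A step at j adds x_j to at least one of the entries k and l, as they are distinct, and at most
    x_j to entry i. Since C >= 1, the gain C x_j on the right absorbs the gain on the left. *)
Lemma balanced_at C B I : 1 <= C -> (forall i, 0 < x B i) -> balanced C (x B) ->
  balanced C (x (basis_at B I)).
Proof.
move=> C1 B0 CB; have C0 : 0 < C by apply: lt_le_trans C1.
suff [] : (forall i, 0 < x (basis_at B I) i) /\ balanced C (x (basis_at B I)) by [].
apply: (@basis_at_ind (fun B => (forall i, 0 < x B i) /\ balanced C (x B))) => // {}B j [{}B0 {}CB].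
split=> [i|i k l kl]; first by rewrite x_step; case: eqP => // _; rewrite addr_gt0.
have xj := B0 j; have xjC : x B j <= C * x B j by rewrite ler_peMl// ltW.
have CM u v : C * (u + v) = C * u + C * v by rewrite mulrDr.
have Cp a : 0 < C * x B a by rewrite mulr_gt0.
rewrite !x_step; have [_|ij] := eqVneq i j; have [kj|kj] := eqVneq k j; have [lj|lj] := eqVneq l j;
  rewrite !CM; try by [rewrite kj lj eqxx in kl]; have := Cp k; have := Cp l; have := Cp j.
- lra.
- lra.
- lra.
- by have := CB i j l; rewrite eq_sym lj CM => /(_ isT); lra.
- by have := CB i k j; rewrite kj CM => /(_ isT); lra.
- by have := CB i k l kl; rewrite CM; lra.
Qed.

(** Steps only add basis vectors: [N] is subadditive and the form is additive, so the bound passes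
    to sums with the same constant. *)
Lemma subadditive_at (N : 'rV[R]_n.+1 -> R) (a : R) B I :
  (forall u v, N (u + v) <= N u + N v) ->
  (forall i, N (tnth B i) <= a * x B i) ->
  forall i, N (tnth (basis_at B I) i) <= a * x (basis_at B I) i.
Proof.
move=> ND; apply: (@basis_at_ind (fun B => forall i, N (tnth B i) <= a * x B i)) => {}B j B0 i.
rewrite x_step tnth_mktuple; case: eqP => // _.
by rewrite mulrDr (le_trans (ND _ _))// lerD.
Qed.

End basis_at_invariants.

(** * Comparison of norms and linear forms *)

Lemma row_coord_le_norm (R : realType) m (v : 'rV[R]_m) i : `|v 0 i| <= `|v|.
Proof.
rewrite [leRHS]/Num.norm /= mx_normrE.
by apply/bigmax_geP; right => /=; exists (0, i).
Qed.

Section norm_comparison.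
Context (R : realType) (m : nat) (N : 'rV[R]_m -> R).
Hypothesis N_norm : is_norm N.

Let ND u v : N (u + v) <= N u + N v. Proof. by case: N_norm. Qed.
Let NZ a v : N (a *: v) = `|a| * N v. Proof. by case: N_norm. Qed.
Let N0 : N 0 = 0. Proof. by rewrite -[X in N X](scale0r 0) NZ normr0 mul0r. Qed.
Let NN v : N (- v) = N v. Proof. by rewrite -scaleN1r NZ normrN normr1 mul1r. Qed.

Lemma is_norm_ge0 v : 0 <= N v.
Proof. by have := ND v (- v); rewrite subrr N0 NN; lra. Qed.

Lemma is_norm_sum (I : finType) (f : I -> 'rV[R]_m) : N (\sum_i f i) <= \sum_i N (f i).
Proof.
elim/big_rec2: _ => [|i y u _ uy]; first by rewrite N0.
by rewrite (le_trans (ND _ _))// lerD2l.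
Qed.

Let N_bound : exists2 K, 0 < K & forall v, N v <= K * `|v|.
Proof.
pose K := 1 + \sum_i N (delta_mx 0 i).
exists K; first by rewrite ltr_wpDr// sumr_ge0// => i _; exact: is_norm_ge0.
move=> v; rewrite {1}(row_sum_delta v) (le_trans (is_norm_sum _))//.
rewrite mulrDl mul1r ler_wpDl// mulr_suml ler_sum// => i _.
rewrite NZ mulrC ler_wpM2l ?is_norm_ge0//.
exact: row_coord_le_norm.
Qed.

Let N_continuous : continuous N.
Proof.
have [K K0 NK] := N_bound.
move=> v; apply/(@cvgrPdist_le _ _ _ (nbhs v)) => e e0.
apply/(@nbhs_normP _ 'rV[R]_m); exists (e / K) => [|u /= /ltW]; first exact: divr_gt0.
rewrite ler_pdivlMr// mulrC => /(le_trans (NK _)) Ne.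
have := ND (v - u) u; have := ND (u - v) v; rewrite !subrK -(opprB v) NN.
by rewrite ler_norml; lra.
Qed.

(** The continuous function [N] attains a positive minimum on the unit sphere of the sup norm, which
    is compact; homogeneity does the rest. *)
Let N_lower : exists2 c, 0 < c & forall v, c * `|v| <= N v.
Proof.
(* In dimension 0 the sphere is empty and has no minimum; any constant serves. *)
have [[v0 v00]|no] := pselect (exists v : 'rV[R]_m, v != 0); last first.
  exists 1 => // v; have -> : v = 0.
    by apply/eqP; apply/negP => /negP v0; apply: no; exists v.
  by rewrite normr0 mulr0 is_norm_ge0.
pose S := [set v : 'rV[R]_m | `|v| = 1].
have normed v : v != 0 -> S (`|v|^-1 *: v).
  by move=> v_neq0; rewrite /S /= normrZ normfV normr_id mulVf// normr_eq0.
have cS : compact S.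
  apply: bounded_closed_compact.
    by exists 1; split=> // x x1 v /= ->; exact: ltW.
  rewrite (_ : S = (fun v : 'rV[R]_m => `|v|) @^-1` [set 1])//.
  apply: closed_comp; last exact: closed_eq.
  by move=> v _; exact: norm_continuous.
have [u uS Nu] := EVT_min_rV (ex_intro _ _ (normed _ v00)) cS (continuous_subspaceT N_continuous).
move: uS; rewrite inE /S /= => u1.
have Nu0 : 0 < N u.
  rewrite lt_neqAle is_norm_ge0 andbT eq_sym; apply/eqP => Nu0.
  case: N_norm => _ _ /(_ _ Nu0) u0; move: u1; rewrite u0 normr0 => /eqP.
  by rewrite eq_sym oner_eq0.
exists (N u) => // v; have [->|v_neq0] := eqVneq v 0.
  by rewrite normr0 mulr0 is_norm_ge0.
have := Nu _ (mem_set (normed _ v_neq0)).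
by rewrite NZ normfV normr_id ler_pdivlMl ?normr_gt0// mulrC.
Qed.

Lemma linform_le_norm (w : 'cV[R]_m) :
  exists2 a, 0 < a & forall v, `|linform w v| <= a * N v.
Proof.
have [c c0 cN] := N_lower; pose K := 1 + \sum_i `|w i 0|.
have K0 : 0 < K by rewrite ltr_wpDr// sumr_ge0.
exists (K / c) => [|v]; first by rewrite divr_gt0.
apply: (@le_trans _ _ (K * `|v|)); last first.
  by rewrite -mulrA; apply: ler_wpM2l; [exact: ltW|rewrite ler_pdivlMl].
rewrite /linform mxE (le_trans (ler_norm_sum _ _ _))//.
rewrite mulrDl ler_wpDl ?mul1r// mulr_suml ler_sum// => i _.
by rewrite normrM mulrC ler_wpM2l// row_coord_le_norm.
Qed.

End norm_comparison.

(** * Two-sided bounds *)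

Lemma barycenter_linform (R : realType) n (w : 'cV[R]_n.+1) (E : n.+1.-tuple 'rV[R]_n.+1) I :
  linform w (barycenter E I) = \sum_i linform w (tnth (basis_at E I) i).
Proof. exact: linform_sum. Qed.

Section body_at.
Context (R : realType) (n : nat) (w : 'cV[R]_n.+1) (E : n.+1.-tuple 'rV[R]_n.+1).
Hypothesis w_gt0 : forall i, 0 < linform w (tnth E i).

Lemma barycenter_gt0 I : 0 < linform w (barycenter E I).
Proof.
rewrite barycenter_linform big_ord_recl ltr_wpDr ?linform_at_gt0// sumr_ge0// => i _.
exact/ltW/linform_at_gt0.
Qed.

(** One balance constant C serves all I. Summing the balance inequality over the n+1 entries gives
    the hypothesis of [body_coord_le] with K = (n+1) C. *)
Lemma body_at_coord_le : basis_mx E \in unitmx ->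
  exists2 K, 0 < K & forall I v u, v != 0 -> body (basis_at E I) (dir v) ->
    `|linform w v| <= u ->
    box n.+1 (- (K * u / linform w (barycenter E I))) (K * u / linform w (barycenter E I))
        (v *m invmx (basis_mx (basis_at E I))).
Proof.
move=> uE; have [C C1 bC] := balanced_exists w_gt0.
have C0 : 0 < C by apply: lt_le_trans C1.
have K0 : 0 < n.+1%:R * C by rewrite mulr_gt0.
exists (n.+1%:R * C) => // I v u v0 vI vu.
have X0 := barycenter_gt0 I.
have [uF _] := basis_mx_at I uE.
have [//|k l kl|t vt tK i] := @body_coord_le _ _ _ w (linform_at_gt0 I w_gt0) (n.+1%:R * C) _ _ v v0 vI.
  apply: (@le_trans _ _ (\sum_(i < n.+1) C * (linform w (tnth (basis_at E I) k) + linform w (tnth (basis_at E I) l)))).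
    by apply: ler_sum => i _; exact: (balanced_at I C1 w_gt0 bC).
  by rewrite sumr_const card_ord -[leLHS]mulr_natl mulrA.
rewrite (_ : v *m _ = t); last by rewrite vt mulmxK.
rewrite -ler_norml (le_trans (tK i))// -barycenter_linform.
by rewrite ler_pM2r ?invr_gt0// ler_pM2l.
Qed.

Lemma linform_box_bounds I (r : R) t : box n.+1 (3 * r) (4 * r) t ->
  3 * r * linform w (barycenter E I) <= linform w (t *m basis_mx (basis_at E I)) <=
  4 * r * linform w (barycenter E I).
Proof.
move=> ts; rewrite mul_basis_mx !linform_sum !mulr_sumr.
by apply/andP; split; apply: ler_sum => i _; rewrite linformZ;
  (rewrite ler_pM2r; last exact: linform_at_gt0); case/andP: (ts i).
Qed.

End body_at.

(** The coordinates sum to at most 4(n+1)r, while 2n t_i >= 6nr; for n >= 2 the former is at most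
    the latter. This is the reason for the interval from 3r to 4r. *)
Lemma box_inner (R : realType) n (r : R) (t : 'rV[R]_n.+1) : (2 <= n)%N -> 0 < r ->
  box n.+1 (3 * r) (4 * r) t ->
  (forall i, 0 < t 0 i) /\ (forall i, \sum_j t 0 j <= (2 * n)%:R * t 0 i).
Proof.
move=> n2 r0 ts; split=> i; have /andP[ti _] := ts i.
  by apply: lt_le_trans ti; rewrite mulr_gt0.
apply: (@le_trans _ _ (\sum_(j < n.+1) 4 * r)).
  by apply: ler_sum => j _; case/andP: (ts j).
rewrite sumr_const card_ord -[leLHS]mulr_natl.
have n2' : 2 <= n%:R :> R by rewrite ler_nat.
apply: (le_trans _ (ler_wpM2l (ler0n _ _) ti)).
by rewrite natrM -natr1; nra.
Qed.

(** * Volume bounds from images of boxes *)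

Section box_images.
Context (R : realType) (m : nat) (F : 'M[R]_m) (S : set 'rV[R]_m).
Hypothesis F_unit : F \in unitmx.

Let lebesgue_box_image (a b : R) : a <= b ->
  lebesgue_rV [set x | box m a b (x *m invmx F)] = ((b - a) ^+ m / volume_factor F)%:E.
Proof.
move=> ab; rewrite (lebesgue_rV_mulmx (A := box m a b)) ?unitmx_inv//; last exact: measurable_box.
by rewrite lebesgue_box// volume_factorV// EFinM.
Qed.

Lemma lebesgue_box_image_le (r : R) : 0 <= r ->
  (forall t, box m (3 * r) (4 * r) t -> S (t *m F)) ->
  ((r ^+ m / volume_factor F)%:E <= lebesgue_rV S)%E.
Proof.
move=> r0 FS; rewrite (_ : r = 4 * r - 3 * r); last by ring.
rewrite -lebesgue_box_image; last by lra.
by apply: le_lebesgue_rV => x /= /FS; rewrite mulmxKV.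
Qed.

Lemma lebesgue_le_box_image (u : R) : 0 <= u ->
  (forall v, S v -> box m (- u) u (v *m invmx F)) ->
  (lebesgue_rV S <= ((2 * u) ^+ m / volume_factor F)%:E)%E.
Proof.
move=> u0 SF; rewrite (_ : 2 * u = u - - u); last by ring.
by rewrite -lebesgue_box_image; [exact: le_lebesgue_rV|lra].
Qed.

End box_images.

(** The estimate is first proved with a linear form in place of the norm, because a form is additive
    along the steps. *)
Definition two_sided_bound (R : realType) n (w : 'cV[R]_n.+1)
    (E : n.+1.-tuple 'rV[R]_n.+1) (mu : set (RP R n) -> \bar R) :=
  exists a b : R, [/\ 0 < a, 0 < b & forall I,
    ((a / linform w (barycenter E I) ^+ n.+1)%:E <= mu (body (basis_at E I)) <=
     (b / linform w (barycenter E I) ^+ n.+1)%:E)%E].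

(** * The measure induced by the sphere *)

Lemma unit_cone_dir (R : realType) n (P : set (RP R n)) (x : 'rV[R]_n.+1) :
  x != 0 -> \sum_i `|x 0 i| <= 1 -> P (dir x) -> unit_cone (@dir R n @^-1` P) x.
Proof.
(* The polar decomposition of x has radius sqrt q; since every |x_i| is at most 1, q is at most the
   sum of the |x_i|. *)
move=> x0 x1 Px; pose q := \sum_i x 0 i ^+ 2.
have q1 : q <= 1.
  apply: (le_trans _ x1); apply: ler_sum => i _.
  rewrite -real_normK ?num_real// expr2 ler_piMl// (le_trans _ x1)//.
  by rewrite (bigD1 i)//= lerDl sumr_ge0.
have q0 : 0 < q.
  have [i xi] : exists i, x 0 i != 0.
    apply/existsP; apply: contraNT x0 => /existsPn x0; apply/eqP/rowP => i.
    by rewrite mxE; apply/eqP; have := x0 i; rewrite negbK.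
  rewrite /q (bigD1 i)//= ltr_wpDr ?sumr_ge0// => [j _|]; first exact: sqr_ge0.
  by rewrite lt_neqAle sqr_ge0 andbT eq_sym sqrf_eq0.
have r0 : 0 < Num.sqrt q by rewrite sqrtr_gt0.
exists (Num.sqrt q), ((Num.sqrt q)^-1 *: x); split.
- by rewrite r0 -[leRHS]sqrtr1 ler_wsqrtr.
- rewrite /unit_sphere /=; under eq_bigr do rewrite mxE exprMn.
  by rewrite -mulr_sumr exprVn sqr_sqrtr ?ltW// mulVf// gt_eqF.
- by rewrite /preimage /= dirZ// invr_neq0// gt_eqF.
- by rewrite scalerA mulfV ?scale1r// gt_eqF.
Qed.

Lemma unit_cone_sub (R : realType) n (P : set (RP R n)) (x : 'rV[R]_n.+1) :
  unit_cone (@dir R n @^-1` P) x -> [/\ x != 0, P (dir x) & forall i, `|x 0 i| <= 1].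
Proof.
move=> [r [v [/andP[r0 r1] v1 vP ->]]]; split; last first.
- move=> i; rewrite mxE normrM gtr0_norm//; apply: mulr_ile1 => //; first exact: ltW.
  rewrite -(@ler_pXn2r _ 2) ?nnegrE// real_normK ?num_real// expr1n.
  by rewrite -[leRHS]v1 (bigD1 i)//= lerDl sumr_ge0// => j _; exact: sqr_ge0.
- by rewrite dirZ// gt_eqF.
rewrite scaler_eq0 negb_or gt_eqF//=; apply/eqP => v0; move: v1.
rewrite v0 /unit_sphere /= big1; first by move/eqP; rewrite eq_sym oner_eq0.
by move=> i _; rewrite mxE expr0n.
Qed.

(** The ratio of the l1 norm to the form on the vectors of E_I never exceeds a bound valid on [E].
    Hence one k, independent of I, tells how small a box must be for its image to lie in the unit
    ball. *)
Lemma box_sum_norm_le (R : realType) n (w : 'cV[R]_n.+1) (E : n.+1.-tuple 'rV[R]_n.+1) :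
  (forall i, 0 < linform w (tnth E i)) ->
  exists2 k, 0 < k & forall I (r : R) t, 0 < r -> box n.+1 (3 * r) (4 * r) t ->
    \sum_j `|(t *m basis_mx (basis_at E I)) 0 j| <= 4 * r * (k * linform w (barycenter E I)).
Proof.
move=> w0; pose N1 (v : 'rV[R]_n.+1) := \sum_j `|v 0 j|.
have N1_ge0 v : 0 <= N1 v by rewrite sumr_ge0.
have N1D u v : N1 (u + v) <= N1 u + N1 v.
  by rewrite /N1 -big_split ler_sum// => j _; rewrite mxE ler_normD.
have N1Z a v : N1 (a *: v) = `|a| * N1 v.
  by rewrite /N1 mulr_sumr; apply: eq_bigr => j _; rewrite mxE normrM.
have N10 : N1 0 = 0 by rewrite /N1 big1// => j _; rewrite mxE normr0.
suff : exists2 k, 0 < k & forall I (r : R) t, 0 < r -> box n.+1 (3 * r) (4 * r) t ->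
    N1 (t *m basis_mx (basis_at E I)) <= 4 * r * (k * linform w (barycenter E I)) by [].
move: N1 N1_ge0 N1D N1Z N10 => N1 N1_ge0 N1D N1Z N10.
pose k := 1 + \sum_i N1 (tnth E i) / linform w (tnth E i).
have d0 i : 0 <= N1 (tnth E i) / linform w (tnth E i) by rewrite divr_ge0// ltW.
have kE i : N1 (tnth E i) <= k * linform w (tnth E i).
  by rewrite -ler_pdivrMr// /k (bigD1 i)//= addrCA lerDl addr_ge0// sumr_ge0.
exists k => [|I r t r0 tr]; first by rewrite ltr_wpDr// sumr_ge0.
rewrite mul_basis_mx barycenter_linform !mulr_sumr.
apply: (@le_trans _ _ (\sum_i N1 (t 0 i *: tnth (basis_at E I) i))).
  elim/big_rec2: _ => [|i y u _ uy]; first by rewrite N10.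
  by rewrite (le_trans (N1D _ _))// lerD2l.
apply: ler_sum => i _; have /andP[ti ti'] := tr i; rewrite N1Z ger0_norm; last first.
  by apply: (le_trans _ ti); rewrite mulr_ge0// ltW.
apply: ler_pM => //; last exact: (subadditive_at I N1D kE).
by apply: (le_trans _ ti); rewrite mulr_ge0// ltW.
Qed.

Lemma sphere_two_sided_bound (R : realType) n (E : n.+1.-tuple 'rV[R]_n.+1) (w : 'cV[R]_n.+1) :
  (2 <= n)%N -> basis_mx E \in unitmx -> (forall i, 0 < linform w (tnth E i)) ->
  two_sided_bound w E (@proj_sphere_measure R n).
Proof.
move=> n2 uE w0; have [K K0 bodyK] := body_at_coord_le w0 uE.
have [k k0 boxk] := box_sum_norm_le w0.
(* [W] bounds the form on the cube around the unit ball, hence on every unit cone. *)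
have [W W0 coneW] : exists2 W, 0 < W &
    forall v : 'rV[R]_n.+1, (forall i, `|v 0 i| <= 1) -> `|linform w v| <= W.
  exists (1 + \sum_i `|w i 0|) => [|v v1]; first by rewrite ltr_wpDr// sumr_ge0.
  rewrite /linform mxE (le_trans (ler_norm_sum _ _ _))// ler_wpDl// ler_sum// => i _.
  by rewrite normrM ler_piMl.
have [c c0 fF] : exists2 c, 0 < c & forall I, volume_factor (basis_mx (basis_at E I)) = c.
  by exists (volume_factor (basis_mx E)) => [|I]; [exact: volume_factor_gt0|case: (basis_mx_at I uE)].
have powE (r X : R) : (r / X) ^+ n.+1 / c = r ^+ n.+1 / c / X ^+ n.+1.
  by rewrite expr_div_n mulrAC.
(* The factor n+1 comes from the cone measure. The inner box has r = 1 / (4kX), so that 4rkX = 1 and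
   its image lies in the l1 unit ball; the outer box has half-side KW / X. Here X is the value of
   the form at the barycenter. *)
exists (n.+1%:R * ((4 * k)^-1 ^+ n.+1 / c)), (n.+1%:R * ((2 * (K * W)) ^+ n.+1 / c)).
split; [by rewrite mulr_gt0// divr_gt0// exprn_gt0// invr_gt0 mulr_gt0|
  by rewrite mulr_gt0// divr_gt0// exprn_gt0// !mulr_gt0|] => I.
have := barycenter_gt0 w0 I; have := boxk I; have := bodyK I; have := linform_box_bounds w0 I.
have [] := basis_mx_at I uE; have := fF I; have := @body_inner _ _ (basis_at E I).
move: (linform w _) (basis_mx (basis_at E I)) => X F inner {}fF uF _ boundsX bodyX boxX X0.
rewrite /proj_sphere_measure /sphere_measure -!(mulrA n.+1%:R) !(EFinM n.+1%:R).
rewrite -!powE; apply/andP; split; (apply: lee_wpmul2l; first by rewrite lee_fin);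
  rewrite -fF.
  have r0 : 0 < (4 * k)^-1 / X by rewrite divr_gt0// invr_gt0 mulr_gt0.
  apply: lebesgue_box_image_le => // [|t tr]; first exact: ltW.
  have [t0 tS] := box_inner n2 r0 tr; have /andP[wx _] := boundsX _ _ tr.
  apply: unit_cone_dir; last exact: inner.
    apply: contraTneq wx => ->; rewrite linform0 -ltNge.
    by rewrite mulr_gt0// mulr_gt0.
  apply: (le_trans (boxX _ _ r0 tr)); rewrite le_eqVlt; apply/orP; left; apply/eqP.
  by field; rewrite !gt_eqF.
rewrite -mulrA; apply: lebesgue_le_box_image => //.
  by rewrite divr_ge0// ltW// mulr_gt0.
by move=> v /unit_cone_sub[v0 vB /coneW]; exact: bodyX.
Qed.

(** * The measures induced by affine charts *)

Lemma row_mx1_head (R : realType) n (x : 'rV[R]_n) :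
  (row_mx 1%:M x : 'rV[R]_n.+1) 0 0 = 1.
Proof.
have -> : (0 : 'I_n.+1) = lshift n (0 : 'I_1) by exact/val_inj.
by rewrite [LHS](row_mxEl (1%:M : 'M[R]_1) x 0 0) mxE.
Qed.

Lemma row_mx1_behead (R : realType) n (x : 'rV[R]_n) j :
  (row_mx 1%:M x : 'rV[R]_n.+1) 0 (lift ord0 j) = x 0 j.
Proof. by rewrite -rshift1 [LHS](row_mxEr (1%:M : 'M[R]_1) x 0 j). Qed.

Lemma row_mx1E (R : realType) n (y : 'rV[R]_n.+1) : y 0 0 != 0 ->
  y = y 0 0 *: (row_mx 1%:M ((y 0 0)^-1 *: row_behead y) : 'rV[R]_n.+1).
Proof.
move=> y0; apply/rowP => i; rewrite [RHS]mxE.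
have [j ->|->] := unliftP ord0 i; last by rewrite row_mx1_head mulr1.
by rewrite row_mx1_behead !mxE mulrA mulfV// mul1r.
Qed.

Lemma coord_measurable_row_mx1 (R : realType) n :
  coord_measurable (fun t : n.-tuple R => (row_mx 1%:M (rowt t) : 'rV[R]_n.+1)).
Proof.
have row_mx1D (x : 'rV[R]_n) : row_mx 1%:M x =
    row_mx 1%:M 0 + x *m row_mx 0 1%:M :> 'rV[R]_(1 + n).
  by rewrite mul_mx_row mulmx0 mulmx1 add_row_mx addr0 add0r.
rewrite (_ : (fun t => _) = (fun t => (row_mx 1%:M 0 : 'rV[R]_n.+1) +
    rowt t *m (row_mx 0 1%:M : 'M[R]_(n, 1 + n)))).
  apply: coord_measurableD; first exact: coord_measurable_cst.
  exact/coord_measurable_mulmx/coord_measurable_rowt.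
by apply/funext => t; exact: row_mx1D.
Qed.

(** For k = 2n these are the coordinate vectors to which [body_inner] applies: a measurable cone
    inside the body, as the truncated cone estimates require. *)
Definition inner_cone (R : realType) m (k : R) : set 'rV[R]_m :=
  [set t | forall i, 0 < t 0 i /\ \sum_j t 0 j <= k * t 0 i].
Arguments inner_cone {R} m k _.

Lemma measurable_inner_cone (R : realType) m (k : R) : measurable_rV (inner_cone m k).
Proof.
have mt : coord_measurable (@rowt R m) by exact: coord_measurable_rowt.
apply: measurable_forall => i.
have mpos : measurable [set t : m.-tuple R | 0 < rowt t 0 i].
  rewrite (_ : mkset _ = (fun t : m.-tuple R => rowt t 0 i) @^-1` [set` `]0, +oo[]).
    exact: (measurable_preimageT (mt i)).
  by apply/funext => t; rewrite /= in_itv/= andbT.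
apply: (measurableI _ _ mpos).
(* The second condition says that the linear form k t_i - sum t is nonnegative. *)
pose f (t : m.-tuple R) := (rowt t *m (k *: delta_mx i 0 - const_mx 1 : 'cV[R]_m)) 0 0.
rewrite (_ : (fun t => _) = f @^-1` [set` `[0, +oo[]).
  by apply: measurable_preimageT => //; exact: (coord_measurable_mulmx _ mt).
apply/funext => t; rewrite /f /= in_itv/= andbT mulmxBr -scalemxAr -colE !mxE subr_ge0.
by congr (is_true (_ <= _)); apply: eq_bigr => j _; rewrite !mxE mulr1.
Qed.

(** The form reads off the homogeneous coordinate that equals 1 on the chart, so it is the height in
    truncated cones. The trace of the body on the chart is enclosed between two measurable sets,
    whose truncated cones are compared with images of boxes. *)
Lemma chart_two_sided_bound (R : realType) n (E : n.+1.-tuple 'rV[R]_n.+1) (T : 'M[R]_n.+1) :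
  (2 <= n)%N -> basis_mx E \in unitmx -> T \in unitmx ->
  (forall i, 0 < linform (col 0 (invmx T)) (tnth E i)) ->
  two_sided_bound (col 0 (invmx T)) E (chart_measure T).
Proof.
set w := col 0 (invmx T) => n2 uE uT w0.
have wT (y : 'rV[R]_n.+1) : linform w (y *m T) = y 0 0.
  by rewrite /linform /w colE !mulmxA mulmxK// -colE mxE.
have [K K0 bodyK] := body_at_coord_le w0 uE.
have uT' : invmx T \in unitmx by rewrite unitmx_inv.
have [c c0 fF] : exists2 c, 0 < c &
    forall I, volume_factor (basis_mx (basis_at E I) *m invmx T) = c.
  exists (volume_factor (basis_mx E *m invmx T)) => [|I].
    by rewrite volume_factor_gt0// unitmx_mul uE.
  by have [uF eF] := basis_mx_at I uE; rewrite (volume_factorM uF uT') eF (volume_factorM uE uT').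
have powE (r X : R) : (r / X) ^+ n.+1 / c = r ^+ n.+1 / c / X ^+ n.+1.
  by rewrite expr_div_n mulrAC.
exists (4^-1 ^+ n.+1 / c), (2 ^+ n.+1 * ((2 * K) ^+ n.+1 / c)).
split; [by rewrite divr_gt0// exprn_gt0// invr_gt0|
  by rewrite mulr_gt0 ?exprn_gt0// divr_gt0// exprn_gt0// mulr_gt0|] => I.
have := barycenter_gt0 w0 I; have := bodyK I; have := linform_box_bounds w0 I.
have [] := basis_mx_at I uE; have := fF I; have := @body_inner _ _ (basis_at E I).
rewrite -(mulrA (2 ^+ n.+1)).
move: (linform w (barycenter E I)) (basis_mx (basis_at E I)) => X F inner fG uF _ boundsX bodyX X0.
have uG : F *m invmx T \in unitmx by rewrite unitmx_mul uF.
have GE (y : 'rV[R]_n.+1) : y *m invmx (F *m invmx T) = y *m T *m invmx F.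
  have yE : y *m T *m invmx F *m (F *m invmx T) = y by rewrite mulmxA mulmxKV// mulmxK.
  by rewrite -{1}yE mulmxK.
(* [M] passes from homogeneous coordinates in the frame [T] to coordinates in the basis E_I. *)
pose M := T *m invmx F.
have mM (A : set 'rV[R]_n.+1) : measurable_rV A ->
    measurable_rV [set x | A ((row_mx 1%:M x : 'rV[R]_n.+1) *m M)].
  move=> mA; apply: measurable_rV_comp mA.
  exact: (coord_measurable_mulmx M (@coord_measurable_row_mx1 R n)).
rewrite /chart_measure; apply/andP; split.
  (* For r = 1 / (4X) the form takes values between 3/4 and 1 on the image of the box, within the
     heights of the truncated cone. *)
  have r0 : 0 < 4^-1 / X by rewrite divr_gt0// invr_gt0.
  pose A := [set x | inner_cone n.+1 (2 * n)%:R ((row_mx 1%:M x : 'rV[R]_n.+1) *m M)].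
  apply: (@le_trans _ _ (lebesgue_rV A)); last first.
    apply: le_lebesgue_rV => x xA; rewrite /preimage /= /chart.
    rewrite -[_ *m T](mulmxKV uF) -[X in dir (X *m _)]mulmxA.
    by apply: inner => // i; case: (xA i).
  have mA : measurable_rV A by apply: (mM (inner_cone n.+1 (2 * n)%:R)); exact: measurable_inner_cone.
  apply: (le_trans _ (lebesgue_truncated_cone_le mA)).
  rewrite -powE -fG; apply: lebesgue_box_image_le => // [|t tr]; first exact: ltW.
  have [t0 tS] := box_inner n2 r0 tr.
  have := boundsX _ _ tr; rewrite -[t *m F](mulmxKV uT) wT mulmxA.
  set y := t *m (F *m invmx T).
  have -> : 3 * (4^-1 / X) * X = 3 / 4 by field; rewrite gt_eqF.
  have -> : 4 * (4^-1 / X) * X = 1 by field; rewrite gt_eqF.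
  rewrite -mulmxA -/y => /andP[y1 y2].
  have y0 : 0 < y 0 0 by lra.
  split; first by rewrite y2 andbT; lra.
  have yM : y *m M = t by rewrite /y /M mulmxA -[t *m _ *m T]mulmxA mulmxKV// mulmxK.
  (* Moving to height 1 multiplies t by a positive scalar, which preserves the inner cone. *)
  have zE : (row_mx 1%:M ((y 0 0)^-1 *: row_behead y) : 'rV[R]_n.+1) *m M = (y 0 0)^-1 *: t.
    apply: (scalerI (lt0r_neq0 y0)); rewrite scalerA mulfV ?gt_eqF// scale1r.
    by rewrite scalemxAl -(row_mx1E (lt0r_neq0 y0)).
  rewrite /A /= zE => i; split; first by rewrite mxE mulr_gt0// invr_gt0.
  under eq_bigr do rewrite mxE.
  by rewrite -mulr_sumr [(_ *: t) 0 i]mxE mulrCA ler_pM2l// invr_gt0.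
have u0 : 0 <= K * 1 / X by rewrite mulr1 divr_ge0// ltW.
(* The form is 1 on the chart, so [bodyK] with u = 1 places the body in this box. Heights at most 1
   shrink coordinates, so the truncated cone stays in the box too. *)
pose A := [set x | box n.+1 (- (K * 1 / X)) (K * 1 / X) ((row_mx 1%:M x : 'rV[R]_n.+1) *m M)].
apply: (@le_trans _ _ (lebesgue_rV A)).
  apply: le_lebesgue_rV => x xB; rewrite /A /= /M mulmxA.
  have w1 : linform w ((row_mx 1%:M x : 'rV[R]_n.+1) *m T) = 1.
    by rewrite wT row_mx1_head.
  apply: bodyX => //; last by rewrite w1 normr1.
  apply/eqP => v0; move: w1; rewrite v0 linform0 => /eqP.
  by rewrite eq_sym oner_eq0.
have mA : measurable_rV A by apply: (mM (box n.+1 _ _)); exact: measurable_box.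
have cone_le : (lebesgue_rV (truncated_cone A) <= ((2 * K) ^+ n.+1 / c / X ^+ n.+1)%:E)%E.
  rewrite -powE -fG -mulrA -[K in K / X]mulr1.
  apply: lebesgue_le_box_image => // y [/andP[y1 y2] yA].
  have y0 : 0 < y 0 0 by apply: lt_le_trans y1; rewrite invr_gt0.
  rewrite GE -mulmxA -/M (row_mx1E (lt0r_neq0 y0)) -scalemxAl => i; have := yA i.
  rewrite -!ler_norml => zu; rewrite mxE normrM gtr0_norm//.
  by rewrite (le_trans _ zu)// ler_piMl.
have := le_trans (lebesgue_truncated_cone_ge mA) cone_le.
rewrite exprVn -lee_pdivlMl ?invr_gt0 ?exprn_gt0// invrK.
by rewrite -!EFinM !mulrA.
Qed.

(** * From the linear form to the norm *)

Lemma two_sided_bound_norm (R : realType) n (w : 'cV[R]_n.+1)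
    (E : n.+1.-tuple 'rV[R]_n.+1) (mu : set (RP R n) -> \bar R) (N : 'rV[R]_n.+1 -> R) :
  is_norm N -> (forall i, 0 < linform w (tnth E i)) -> two_sided_bound w E mu ->
  exists A B : R, [/\ 0 < A, 0 < B & forall I,
    ((A / N (barycenter E I) ^+ n.+1)%:E <= mu (body (basis_at E I)) <=
     (B / N (barycenter E I) ^+ n.+1)%:E)%E].
Proof.
move=> nN w0 [a [b [a0 b0 ab]]].
have [p p0 wN] := linform_le_norm nN w.
(* A form can vanish at nonzero vectors, so it does not dominate [N] everywhere; at the vectors of
   E_I it does, with a constant [q] read off from [E]. *)
pose q := 1 + \sum_i N (tnth E i) / linform w (tnth E i).
have d0 i : 0 <= N (tnth E i) / linform w (tnth E i).
  by rewrite divr_ge0 ?(is_norm_ge0 nN)// ltW.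
have q0 : 0 < q by rewrite ltr_wpDr// sumr_ge0.
have qE i : N (tnth E i) <= q * linform w (tnth E i).
  by rewrite -ler_pdivrMr// /q (bigD1 i)//= addrCA lerDl addr_ge0// sumr_ge0.
exists (a / p ^+ n.+1), (b * q ^+ n.+1).
split; [by rewrite divr_gt0// exprn_gt0|by rewrite mulr_gt0// exprn_gt0|] => I.
have ND : forall u v, N (u + v) <= N u + N v by case: nN.
have Nq : N (barycenter E I) <= q * linform w (barycenter E I).
  rewrite barycenter_linform mulr_sumr (le_trans (is_norm_sum nN _))// ler_sum// => i _.
  exact: (subadditive_at I ND qE).
have X0 := barycenter_gt0 w0 I; have /andP[aI bI] := ab I.
have := wN (barycenter E I); rewrite gtr0_norm// => Xp.
have N0 : 0 < N (barycenter E I) by have := lt_le_trans X0 Xp; rewrite pmulr_rgt0.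
move: (N _) (linform w _) N0 X0 Xp Nq aI bI => y X y0 X0 Xp Nq aI bI.
apply/andP; split; [apply: le_trans aI|apply: (le_trans bI)]; rewrite lee_fin.
  rewrite -mulrA -invfM -exprMn ler_pM2l// lef_pV2 ?posrE ?exprn_gt0// ?mulr_gt0//.
  by rewrite lerXn2r// nnegrE ltW// mulr_gt0.
have XV : X^-1 <= q / y by rewrite -[X^-1]mul1r ler_pdivrMr// mulrAC ler_pdivlMr// mul1r.
rewrite -mulrA ler_pM2l// -expr_div_n -exprVn; apply: lerXn2r => //; rewrite nnegrE.
  by rewrite invr_ge0 ltW.
by rewrite divr_ge0// ltW.
Qed.

(** * Sign of the chart form on the simplex *)

Lemma linform_chart (R : realType) n (T : 'M[R]_n.+1) (y : 'rV[R]_n.+1) : T \in unitmx ->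
  linform (col 0 (invmx T)) (y *m T) = y 0 0.
Proof. by move=> uT; rewrite /linform colE !mulmxA mulmxK// -colE mxE. Qed.

Lemma range_chart_linform (R : realType) n (T : 'M[R]_n.+1) v : T \in unitmx ->
  v != 0 -> range (chart T) (dir v) -> linform (col 0 (invmx T)) v != 0.
Proof.
move=> uT v0 [x _ xv]; set y : 'rV[R]_n.+1 := row_mx 1%:M x *m T.
have y1 : linform (col 0 (invmx T)) y = 1 by rewrite linform_chart// row_mx1_head.
have y0 : y != 0.
  by apply/eqP => y0; move: y1; rewrite y0 linform0 => /eqP; rewrite eq_sym oner_eq0.
have [k vk] := dir_eq v0 y0 (esym xv).
by rewrite vk linformZ y1 mulr1; apply: contraNneq v0 => k0; rewrite vk k0 scale0r.
Qed.

(** If the form were a > 0 at e_i and b < 0 at e_j, it would vanish at -b e_i + a e_j, a point of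
    the simplex outside the chart. *)
Lemma linform_chart_sign (R : realType) n (E : n.+1.-tuple 'rV[R]_n.+1) (T : 'M[R]_n.+1) :
  basis_mx E \in unitmx -> T \in unitmx -> simplex E `<=` range (chart T) ->
  (forall i, 0 < linform (col 0 (invmx T)) (tnth E i)) \/
  (forall i, linform (col 0 (invmx T)) (tnth E i) < 0).
Proof.
set w := col 0 _ => uE uT ET.
have cone_neq0 (t : 'rV[R]_n.+1) : t != 0 -> (forall i, 0 <= t 0 i) ->
    linform w (t *m basis_mx E) != 0.
  move=> t0 tge0; apply: range_chart_linform => //.
    by apply: contra_neq t0 => tE; rewrite -(mulmxK uE t) tE mul0mx.
  apply: ET; exists (fun i => t 0 i); split=> //; last by rewrite mul_basis_mx.
  have /existsP[i ti] : [exists i, t 0 i != 0].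
    apply: contraNT t0 => /existsPn t0; apply/eqP/rowP => i; rewrite mxE.
    by apply/eqP; have := t0 i; rewrite negbK.
  by exists i.
have delta_row i : delta_mx 0 i *m basis_mx E = tnth E i by rewrite -rowE rowK.
have neq0 i : linform w (tnth E i) != 0.
  rewrite -delta_row; apply: cone_neq0 => [|j]; last by rewrite mxE ler0n.
  by apply/eqP => /rowP/(_ i); rewrite !mxE !eqxx => /eqP; rewrite oner_eq0.
have same i j : 0 < linform w (tnth E i) -> linform w (tnth E j) < 0 -> False.
  set a := linform w (tnth E i); set b := linform w (tnth E j) => a0 b0.
  pose v : 'rV[R]_n.+1 := - b *: delta_mx 0 i + a *: delta_mx 0 j.
  have v0 : v != 0.
    have ij : i != j by apply/eqP => ij; move: a0 b0; rewrite /a /b ij; lra.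
    apply/eqP => /rowP/(_ j); rewrite !mxE !eqxx eq_sym (negbTE ij) mulr0 add0r mulr1.
    by move=> a00; rewrite a00 ltxx in a0.
  have v_ge0 k : 0 <= v 0 k.
    by rewrite !mxE addr_ge0// mulr_ge0// ?ler0n// ltW// oppr_gt0.
  have := cone_neq0 v v0 v_ge0.
  rewrite mulmxDl -!scalemxAl !delta_row linformD !linformZ -/a -/b.
  by rewrite mulNr mulrC addNr eqxx.
have := neq0 ord0; rewrite neq_lt => /orP[l0|l0]; [right|left] => i;
  have := neq0 i; rewrite neq_lt => /orP[]// li; exfalso; exact: same l0 li || exact: same li l0.
Qed.

Theorem theorem4 (R : realType) (n : nat) (hn : (2 <= n)%N)
    (E : n.+1.-tuple 'rV[R]_n.+1) (hE : basis_of fullv E)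
    (N : 'rV[R]_n.+1 -> R) (hN : is_norm N)
    (mu : set (RP R n) -> \bar R) (hmu : admissible_measure E mu) :
  exists A B : R, [/\ 0 < A, 0 < B &
    finite_set [set I : seq 'I_n.+1 |
      ~ (((A / N (barycenter E I) ^+ n.+1)%:E <= mu (body (basis_at E I)))%E /\
         (mu (body (basis_at E I)) <= (B / N (barycenter E I) ^+ n.+1)%:E)%E)]].
Proof.
have uE := basis_mx_unit hE.
suff [w w0 wmu] : exists2 w, forall i, 0 < linform w (tnth E i) & two_sided_bound w E mu.
  have [A [B [A0 B0 AB]]] := two_sided_bound_norm hN w0 wmu.
  (* The bounds hold for every I, so the exceptional set is empty. *)
  exists A, B; split=> //; rewrite (_ : mkset _ = set0); first exact: finite_set0.
  by rewrite -subset0 => I /= []; case/andP: (AB I).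
case: hmu => [->|[T [uT ET ->]]].
  (* For the sphere the form is the sum of the coordinates in [E], equal to 1 at each basis
     vector. *)
  have w0 i : 0 < linform (invmx (basis_mx E) *m const_mx 1) (tnth E i).
    rewrite -[tnth E i](rowK (fun i => tnth E i) i) -/(basis_mx E) rowE.
    rewrite /linform mulmxA mulmxK// mxE (bigD1 i)//= big1 => [|j ji].
      by rewrite !mxE !eqxx mulr1 addr0.
    by rewrite !mxE eqxx (negbTE ji) mul0r.
  by exists (invmx (basis_mx E) *m const_mx 1); last exact: sphere_two_sided_bound.
case: (linform_chart_sign uE uT ET) => w0.
  by exists (col 0 (invmx T)); last exact: chart_two_sided_bound.
(* T and -T define the same chart. *)
have uNT : -1 *: T \in unitmx by rewrite unitmxZ// unitrN1.
have w0' i : 0 < linform (col 0 (invmx (-1 *: T))) (tnth E i).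
  rewrite invmxZ// invrN1 scaleN1r /linform linearN mulmxN mxE oppr_gt0; exact: w0.
have chartN : chart T = chart (-1 *: T).
  by apply/funext => x; rewrite /chart -scalemxAr dirZ// oppr_eq0 oner_eq0.
exists (col 0 (invmx (-1 *: T))) => //; rewrite /chart_measure chartN.
exact: chart_two_sided_bound.
Qed.
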